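(* Let $a>b>0$ and consider the magic billiard with flipping over the long axis within the ellipse $\mathcal{E}:\ \frac{x^2}{a}+\frac{y^2}{b}=1$. Let $n$ be a positive integer. The trajectories of this billiard with caustic $\mathcal{C}_\beta$ are $n$-periodic if and only if there exists a pair of real polynomials $p_{d_1}$, $q_{d_2}$ of degrees $d_1$, $d_2$ respectively, satisfying the following: (a) if $n=2m$ is even, then $d_1=m$, $d_2=m-2$, and $$p_m^2(s)-s\left(s-\frac1a\right)\left(s-\frac1b\right)\left(s-\frac1\beta\right)q_{m-2}^2(s)=1;$$ (b) if $n=2m+1$ is odd, then $d_1=m$, $d_2=m-1$, and $$\left(s-\frac1b\right)p_m^2(s)-s\left(s-\frac1a\right)\left(s-\frac1\beta\right)q_{m-1}^2(s)=-1.$$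
   Context: Confocal family: $\mathcal{C}_\lambda:\ \frac{x^2}{a-\lambda}+\frac{y^2}{b-\lambda}=1$, so $\mathcal{E}=\mathcal{C}_0$; $\mathcal{C}_\lambda$ is an ellipse for $\lambda<b$ and a hyperbola for $b<\lambda<a$. Magic billiard with flipping over the long axis: let $D$ be the closed domain bounded by $\mathcal{E}$, and let $\varphi$ be the reflection of the plane with respect to the longer axis of $\mathcal{E}$, $\varphi(x,y)=(x,-y)$. A particle moves with unit speed along straight segments inside $D$. When it hits $\mathcal{E}$ at a point $A$ with velocity $\vec v$, it continues from the point $\varphi(A)$ with velocity $\varphi^*(\vec v)=d\varphi(\rho_A(\vec v))$, where $\rho_A$ is the usual billiard reflection (reflection of vectors with respect to the tangent line to $\mathcal{E}$ at $A$). Caustic: each trajectory has a unique conic $\mathcal{C}_\beta$ of the confocal family such that the lines containing the segments of the trajectory are all tangent to $\mathcal{C}_\beta$; it is called the caustic of the trajectory. The caustic is nondegenerate, i.e. $\beta\in(0,b)\cup(b,a)$. $n$-periodic: after $n$ consecutive hits at the boundary the particle returns to its initial position and velocity ($n$ is not required to be the minimal such number). A polynomial of negative degree is understood to be the zero polynomial. *)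

(* Defs.v *)
From mathcomp Require Import all_boot all_order all_algebra.
From mathcomp Require Import reals.

Set Implicit Arguments.
Unset Strict Implicit.
Unset Printing Implicit Defensive.

Import Order.TTheory GRing.Theory Num.Theory.
Local Open Scope ring_scope.

Section MagicBilliard.
Variable R : realType.
Implicit Types (a b lam t : R) (A B v : R * R) (pos vel : nat -> R * R).

Definition on_ellipse a b A : Prop := A.1 ^+ 2 / a + A.2 ^+ 2 / b = 1.

(* The linear reflection in the longer axis.  It is its own differential, so it
   is applied to points and to velocities alike. *)
Definition flip A : R * R := (A.1, - A.2).

(* Reflection of the vector [v] in the tangent line to the ellipse at [B]:
   v - 2 (<v, N> / <N, N>) N, where N = (x_B / a, y_B / b) is normal to the
   ellipse at [B]. *)
Definition reflect_at a b B v : R * R :=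
  let N := (B.1 / a, B.2 / b) in
  let c := 2 * (v.1 * N.1 + v.2 * N.2) / (N.1 ^+ 2 + N.2 ^+ 2) in
  (v.1 - c * N.1, v.2 - c * N.2).

Definition move A v t : R * R := (A.1 + t * v.1, A.2 + t * v.2).

(* From the boundary point [A] the particle moves with velocity [v] until it
   hits the ellipse at [B]; it continues from [A'] with velocity [v'].  By
   strict convexity there is at most one such [t > 0], and the segment [A B]
   lies in the closed domain bounded by the ellipse. *)
Definition magic_step a b A v A' v' : Prop :=
  exists t, let B := move A v t in
  [/\ 0 < t, on_ellipse a b B, A' = flip B & v' = flip (reflect_at a b B v)].

(* The k-th segment starts at the boundary point [pos k], with velocity
   [vel k]. *)
Definition magic_trajectory a b pos vel : Prop :=
  forall k : nat,
    [/\ on_ellipse a b (pos k),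
        (vel k).1 ^+ 2 + (vel k).2 ^+ 2 = 1
      & magic_step a b (pos k) (vel k) (pos k.+1) (vel k.+1)].

(* Polarization of X^2 / (a - lam) + Y^2 / (b - lam) - Z^2, the equation of the
   confocal conic C_lam in homogeneous coordinates ((X, Y), Z). *)
Definition confocal_form a b lam (P Q : R * R * R) : R :=
  P.1.1 * Q.1.1 / (a - lam) + P.1.2 * Q.1.2 / (b - lam) - P.2 * Q.2.

(* The line through [A] with direction [v] is the tangent line to C_lam at some
   point [P] of C_lam, i.e. it is {Q | confocal_form P Q = 0}.  The point of
   tangency may be at infinity: the asymptotes of a hyperbola are tangent to it,
   and segments of trajectories may lie on them. *)
Definition tangent_confocal a b lam A v : Prop :=
  exists P : R * R * R,
    [/\ P <> (0, 0, 0), confocal_form a b lam P P = 0,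
        confocal_form a b lam P (A, 1) = 0
      & confocal_form a b lam P (v, 0) = 0].

Definition has_caustic a b lam pos vel : Prop :=
  forall k : nat, tangent_confocal a b lam (pos k) (vel k).

(* [n] need not be the minimal period. *)
Definition n_periodic (n : nat) pos vel : Prop :=
  pos n = pos 0%N /\ vel n = vel 0%N.

(* The degree is exactly [d]; for [d < 0] the polynomial is zero. *)
Definition has_degree (p : {poly R}) (d : int) : Prop :=
  if 0 <= d then (size p)%:Z = d + 1 else p = 0.

End MagicBilliard.

(* Main.v *)
Require Import Defs.
From mathcomp Require Import all_boot all_order all_algebra.
From mathcomp Require Import zify ring lra.
From mathcomp Require Import reals.

(* Put s = 1 / lambda.  For a boundary point A and a unit velocity v, the Gram
   matrix of the confocal form C_lambda on (A, 1) and (v, 0), multiplied by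
   (a s - 1) (b s - 1) and by the symplectic matrix, is a polynomial matrix L(s)
   with trace 0 and determinant - a b beta s (s - 1/a) (s - 1/b) (s - 1/beta).
   A bounce of the billiard conjugates L by a product W(s) of two unipotent
   matrices, linear in s, and the flip does not change L.  At s = 1/a and
   s = 1/b the matrix W acts on the first, resp. second, coordinates of (A, v)
   as the bounce does, so that the flip becomes a sign at s = 1/b.  Let T be the
   product of the matrices W over n bounces.
   If the trajectory is n-periodic, T commutes with L, so T = P + Q L, where
   P has degree n and det T = 1 is a Pell equation for P and Q; moreover
   P = 1 at s = 0 and s = 1/a, and P = (-1)^n at s = 1/b.  Conversely P + Q L is
   equal to T for any trajectory with this caustic, because a polynomial matrix
   of this kind factors uniquely into matrices W; evaluation at 1/a and 1/b then
   gives periodicity.  Finally P - 1 and P + 1 are coprime with product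
   (squarefree quartic) Q^2, so each is a square up to a constant and linear
   factors; the values of P and the parity of n tell which factors. *)

Set Implicit Arguments.
Unset Strict Implicit.
Unset Printing Implicit Defensive.

Import Order.TTheory GRing.Theory Num.Theory.
Local Open Scope ring_scope.

(** * Pell equations *)

(** With [r] the gcd of [u] and [q], and [u'], [q'] the cofactors, [u' * v = r * q' ^+ 2]. Since
    [u'] is coprime to [q'] and [r] is coprime to [v], [u'] and [r] divide each other, so [u] is
    [r ^+ 2] up to a constant. *)
Lemma coprimep_mul_sqr (F : fieldType) (u v q : {poly F}) :
  u != 0 -> coprimep u v -> u * v = q ^+ 2 ->
    exists (c : F) (r : {poly F}), u = c *: r ^+ 2.
Proof.
move=> u0 cuv euv; have r0 : gcdp u q != 0 by rewrite gcdp_eq0 negb_and u0.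
set r := gcdp u q in r0 *; pose u' := u %/ r; pose q' := q %/ r.
have Eu : u = u' * r by rewrite divpK ?dvdp_gcdl.
have Eq : q = q' * r by rewrite divpK ?dvdp_gcdr.
have E : u' * v = r * q' ^+ 2.
  by apply: (mulfI r0); rewrite mulrA (mulrC r u') -Eu euv Eq; ring.
have cuq : coprimep u' q' by rewrite coprimep_div_gcd // u0.
have u'r : u' %| r.
  by rewrite -(Gauss_dvdpl r (coprimep_expr 2 cuq)) -E dvdp_mulr.
have ru' : r %| u'.
  by rewrite -(Gauss_dvdpl u' (coprimep_dvdr (dvdp_gcdl u q) cuv)) E dvdp_mulr.
have /eqpf_eq [c _ Ec] : u' %= r by rewrite /eqp u'r.
by exists c, r; rewrite Eu Ec expr2 scalerAl.
Qed.

(** One of [u], [v] has the root [z]; dividing that factor by ['X - z%:P] leaves two coprime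
    polynomials whose product is a square. *)
Lemma coprimep_mul_sqr_XsubC (F : fieldType) (z : F) (u v q : {poly F}) :
    u != 0 -> v != 0 -> coprimep u v -> u * v = ('X - z%:P) * q ^+ 2 ->
  exists (c : F) (r : {poly F}) (d : F) (s : {poly F}),
    u = c *: r ^+ 2 * ('X - z%:P) /\ v = d *: s ^+ 2
               \/ u = c *: r ^+ 2 /\ v = d *: s ^+ 2 * ('X - z%:P).
Proof.
move=> u0 v0 cuv E; have z0 : 'X - z%:P != 0 :> {poly F}.
  by rewrite polyXsubC_eq0.
have : root (u * v) z by rewrite E rootM root_XsubC eqxx.
rewrite rootM => /orP[] /factor_theorem [w Ew]; subst.
  have w0 : w != 0 by move: u0; rewrite mulf_eq0 negb_or => /andP[].
  have E' : w * v = q ^+ 2 by apply: (mulfI z0); rewrite -E; ring.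
  have cwv : coprimep w v by apply: coprimep_dvdr cuv; apply: dvdp_mulr.
  have [c [r Er]] := coprimep_mul_sqr w0 cwv E'.
  have [|d [s Es]] := coprimep_mul_sqr v0 _ (etrans (mulrC _ _) E').
    by rewrite coprimep_sym.
  by exists c, r, d, s; left; rewrite Er.
have w0 : w != 0 by move: v0; rewrite mulf_eq0 negb_or => /andP[].
have E' : u * w = q ^+ 2 by apply: (mulfI z0); rewrite -E; ring.
have cwv : coprimep u w by apply: coprimep_dvdl cuv; apply: dvdp_mulr.
have [c [r Er]] := coprimep_mul_sqr u0 cwv E'.
have [|d [s Es]] := coprimep_mul_sqr w0 _ (etrans (mulrC _ _) E').
  by rewrite coprimep_sym.
by exists c, r, d, s; right; rewrite Es.
Qed.

Lemma size_scale_sqr (F : fieldType) (c : F) (r : {poly F}) :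
  c *: r ^+ 2 != 0 -> size (c *: r ^+ 2) = (2 * (size r).-1).+1.
Proof.
rewrite scaler_eq0 negb_or expf_eq0 /= => /andP[c0 r0].
rewrite size_scale // -[size _]prednK ?size_exp 1?mulnC //.
by rewrite lt0n size_poly_eq0 expf_eq0.
Qed.

Lemma size_mul_XsubC (F : fieldType) (z : F) (p : {poly F}) :
  p != 0 -> size (p * ('X - z%:P)) = (size p).+1.
Proof. by move=> p0; rewrite size_Mmonic ?monicXsubC // size_XsubC addn2. Qed.

Definition monic_quartic (F : fieldType) (z1 z2 z3 : F) : {poly F} :=
  'X * ('X - z1%:P) * ('X - z2%:P) * ('X - z3%:P).

(** The form in which periodicity appears for both parities of [n]: [P] is half the trace of the
    product of [n] transfer matrices, with [z1], [z2], [z3] the inverses of [a], [b], [beta]. The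
    value at [z2] records the [n] flips. *)
Definition pell_at (F : fieldType) (n : nat) (z1 z2 z3 : F) (P Q : {poly F}) :=
  [/\ size P = n.+1, P ^+ 2 - monic_quartic z1 z2 z3 * Q ^+ 2 = 1,
      P.[0] = 1, P.[z1] = 1 & P.[z2] = (-1) ^+ n].

Section PellReduction.
Variable F : rcfType.
Implicit Types (z c d : F) (P Q p q r s : {poly F}).

Lemma size_polyDC P c : (1 < size P)%N -> size (P + c%:P) = size P.
Proof. by move=> sP; rewrite size_polyDl // (leq_ltn_trans _ sP) //
  size_polyC_leq1. Qed.

Lemma lead_coefDC P c :
  (1 < size P)%N -> lead_coef (P + c%:P) = lead_coef P.
Proof. by move=> sP; rewrite lead_coefDl // (leq_ltn_trans _ sP) //
  size_polyC_leq1. Qed.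

Lemma coprimep_add1_sub1 P : coprimep (P + 1%:P) (P + (-1)%:P).
Proof.
apply/Bezout_eq1_coprimepP; exists ((2^-1)%:P, - (2^-1)%:P) => /=.
rewrite mulNr -mulrBr opprD addrACA subrr add0r -polyCN opprK -polyCD -polyCM.
by congr (_%:P); field.
Qed.

(* [P + 1] and [P - 1] are coprime and their product is a square times a
   squarefree polynomial, so each of them is a square times a constant and some
   of the linear factors; [z] is allotted by the parity of the degree. *)
Lemma pell_squares n P Q h1 h2 z :
    (0 < n)%N -> size P = n.+1 -> h1 \is monic -> h2 \is monic ->
    odd (size h1) = ~~ odd n -> h1 %| P + 1%:P -> h2 %| P + (-1)%:P ->
    P ^+ 2 - 1 = h1 * h2 * ('X - z%:P) * Q ^+ 2 ->
  exists e p q, [/\ e ^+ 2 = 1,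
    P + 1%:P = (2 * e) *: (h1 * p ^+ 2),
    P + (-1)%:P = (2 * e) *: (h2 * ('X - z%:P) * q ^+ 2),
    p != 0 & q != 0].
Proof.
move=> n0 sP m1 m2 odd1 /dvdpP[u Eu] /dvdpP[v Ev] pellP.
have sP1 : (1 < size P)%N by rewrite sP.
have sPu : size (P + 1%:P) = n.+1 by rewrite size_polyDC.
have Pu0 : P + 1%:P != 0 by rewrite -size_poly_eq0 sPu.
have Pv0 : P + (-1)%:P != 0 by rewrite -size_poly_eq0 size_polyDC // sP.
have h10 := monic_neq0 m1; have h20 := monic_neq0 m2.
have u0 : u != 0 by move: Pu0; rewrite Eu mulf_eq0 negb_or => /andP[].
have v0 : v != 0 by move: Pv0; rewrite Ev mulf_eq0 negb_or => /andP[].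
have cuv : coprimep u v.
  have vP : v %| P + (-1)%:P by rewrite Ev dvdp_mulr.
  have uP : u %| P + 1%:P by rewrite Eu dvdp_mulr.
  exact: coprimep_dvdr uP (coprimep_dvdl vP (coprimep_add1_sub1 P)).
have E : u * v = ('X - z%:P) * Q ^+ 2.
  apply: (mulIf (mulf_neq0 h10 h20)).
  have -> : u * v * (h1 * h2) = (u * h1) * (v * h2) by ring.
  rewrite -Eu -Ev; have -> : (P + 1%:P) * (P + (-1)%:P) = P ^+ 2 - 1.
    by rewrite polyCN polyC1; ring.
  by rewrite pellP; ring.
have [c [r [d [s [] [Er Es]]]]] := coprimep_mul_sqr_XsubC u0 v0 cuv E.
  have h0 : c *: r ^+ 2 != 0 by move: u0;
    rewrite Er mulf_eq0 negb_or => /andP[].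
  move: sPu; rewrite Eu size_Mmonic // Er size_mul_XsubC // size_scale_sqr //.
  by move: odd1; move: (size r) (size h1) => k l; clear; lia.
have h0 : d *: s ^+ 2 != 0 by move: v0; rewrite Es mulf_eq0 negb_or => /andP[].
have [c0 d0] : c != 0 /\ d != 0.
  by split; [move: u0; rewrite Er | move: h0];
    rewrite scaler_eq0 negb_or => /andP[].
have [r0 s0] : r != 0 /\ s != 0.
  by split; [move: u0; rewrite Er | move: h0];
    rewrite scaler_eq0 negb_or expf_eq0 => /andP[].
(* [P + 1] and [P - 1] have the same leading coefficient, so [c] and [d] have a common sign [e];
   their absolute values, halved, go into the squares. *)
have sgcd : Num.sg c = Num.sg d.
  have : lead_coef (P + 1%:P) = lead_coef (P + (-1)%:P).
    by rewrite !lead_coefDC.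
  rewrite Eu Ev !lead_coef_Mmonic // Er Es lead_coef_Mmonic ?monicXsubC //.
  rewrite !lead_coefZ !lead_coef_exp => /(congr1 Num.sg).
  by rewrite !sgrM -!expr2 !sqr_sg !lead_coef_eq0 r0 s0 !mulr1.
have half w : w = 2 * Num.sg w * Num.sqrt (`|w| / 2) ^+ 2.
  rewrite sqr_sqrtr ?divr_ge0 //
    -mulrA mulrCA [_ / 2]mulrC mulVKf ?pnatr_eq0 //.
  exact: numEsg.
exists (Num.sg c), (Num.sqrt (`|c| / 2) *: r), (Num.sqrt (`|d| / 2) *: s).
split.
- by rewrite sqr_sg c0.
- by rewrite exprZn -scalerAr scalerA -half Eu Er -scalerAl (mulrC h1).
- rewrite exprZn -scalerAr scalerA sgcd -half Ev Es -!scalerAl.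
  by congr (_ *: _); ring.
- by rewrite scaler_eq0 negb_or r0 sqrtr_eq0 -ltNge divr_gt0 ?normr_gt0.
- by rewrite scaler_eq0 negb_or s0 sqrtr_eq0 -ltNge divr_gt0 ?normr_gt0.
Qed.

Lemma sign_neq0 (e : F) : e ^+ 2 = 1 -> 2 * e != 0.
Proof.
by move=> e2; rewrite mulf_neq0 ?pnatr_eq0 // -sqrf_eq0 e2 oner_eq0.
Qed.

Lemma size_sqr P : P != 0 -> size (P ^+ 2) = (2 * (size P).-1).+1.
Proof.
by move=> P0; rewrite -[P ^+ 2]scale1r size_scale_sqr // scale1r expf_neq0.
Qed.

(** Backwards, [P = 2 p^2 - 1] and [Q = 2 p q] come from squaring the Pell solution [(p, q)].
    Forwards, [P - 1] vanishes at 0, [z1] and [z2], so [pell_squares] gives [P + 1 = 2 p^2] and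
    [P - 1 = 2 W q^2] with [W] the quartic; subtracting yields the equation. *)
Lemma pell_even n m z1 z2 z3 :
    z1 != 0 -> z2 != 0 -> z1 != z2 -> (0 < n)%N -> n = (2 * m)%N ->
  (exists P Q, pell_at n z1 z2 z3 P Q) <->
  exists p q, [/\ size p = m.+1, (size q).+1 = m, q != 0 &
    p ^+ 2 - monic_quartic z1 z2 z3 * q ^+ 2 = 1].
Proof.
move=> z10 z20 z12 n0 En; split; last first.
  move=> [p [q [sp sq q0 e]]].
  have ev z : (monic_quartic z1 z2 z3).[z] = 0 -> p.[z] ^+ 2 = 1.
    move=> wz; have := congr1 (fun r : {poly F} => r.[z]) e.
    by rewrite /= hornerD hornerN horner_exp hornerM wz mul0r subr0 hornerC.
  exists (2 *: p ^+ 2 + (-1)%:P), (2 *: (p * q)).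
  have p0 : p != 0 by rewrite -size_poly_eq0 sp.
  have s2 : size (2 *: p ^+ 2) = n.+1.
    by rewrite size_scale ?pnatr_eq0 // size_sqr // sp En.
  have evP z : (monic_quartic z1 z2 z3).[z] = 0 ->
      (2 *: p ^+ 2 + (-1)%:P).[z] = 1.
    by move=> /ev pz; rewrite hornerD hornerZ horner_exp pz hornerC; ring.
  split.
  - by rewrite size_polyDC s2.
  - rewrite -!mul_polyC polyCN polyC1.
    have {}e : monic_quartic z1 z2 z3 * q ^+ 2 = p ^+ 2 - 1 by rewrite -e; ring.
    have -> : monic_quartic z1 z2 z3 * (2%:P * (p * q)) ^+ 2
        = (2%:P) ^+ 2 * p ^+ 2 * (monic_quartic z1 z2 z3 * q ^+ 2) by ring.
    by rewrite e polyCMn polyC1; ring.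
  - by apply: evP; rewrite /monic_quartic !hornerM hornerX !mul0r.
  - by apply: evP; rewrite /monic_quartic !hornerM !hornerXsubC subrr !(mulr0,
    mul0r).
  - rewrite En exprM sqrrN expr1n expr1n.
    by apply: evP; rewrite /monic_quartic !hornerM !hornerXsubC subrr !(mulr0,
      mul0r).
move=> [P [Q [sP pellP P0 P1 P2]]].
have m2 : 'X * ('X - z1%:P) * ('X - z2%:P) \is @monic F.
  by rewrite !rpredM ?monicX ?monicXsubC.
have d1 : 1 %| P + 1%:P by rewrite dvd1p.
have [||v Ev] := @uniq_roots_prod_XsubC _ (P + (-1)%:P) [:: 0; z1; z2].
- rewrite /= /root !hornerD !hornerC P0 P1 P2 En exprM sqrrN expr1n.
  by rewrite expr1n subrr eqxx.
- by rewrite uniq_rootsE /= !inE !negb_or z12 !(eq_sym 0) z10 z20.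
have d2 : 'X * ('X - z1%:P) * ('X - z2%:P) %| P + (-1)%:P.
  by rewrite Ev !big_cons big_nil mulr1 polyC0 subr0 dvdp_mull // mulrA.
have [||e [p [q [e2 Ep Eq p0 q0]]]] :=
    pell_squares (Q := Q) (z := z3) n0 sP (monic1 _) m2 _ d1 d2.
- by rewrite size_poly1 En; clear; lia.
- by rewrite -[X in _ - X]pellP /monic_quartic; ring.
have e0 := sign_neq0 e2.
(* The sign is read off at 0, where [P + 1] is positive. *)
have e1 : e = 1.
  have := congr1 (fun r : {poly F} => r.[0]) Ep.
  rewrite /= !hornerD hornerC P0 hornerZ mul1r horner_exp => h.
  have ep : 0 < e * p.[0] ^+ 2
    by rewrite -(pmulr_rgt0 _ (ltr0Sn F 1)) mulrA -h addr_gt0.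
  have {}ep : 0 < e.
    have := ltW ep; rewrite pmulr_lge0; last first.
      by rewrite lt0r sqr_ge0 andbT; apply/eqP => h0; move: ep;
        rewrite h0 mulr0 ltxx.
    by move=> ep'; rewrite lt0r ep' andbT; apply: contraNneq e0 => ->;
      rewrite mulr0.
  by move/eqP: e2; rewrite sqrf_eq1 => /orP[/eqP//|/eqP h']; move: ep;
    rewrite h'; lra.
exists p, q.
have sp : (0 < size p)%N by rewrite lt0n size_poly_eq0.
have sq : (0 < size q)%N by rewrite lt0n size_poly_eq0.
split=> //.
- have := congr1 (size : {poly F} -> nat) Ep.
  rewrite size_polyDC ?sP // size_scale // mul1r size_sqr // En.
  by move: sp; move: (size p) => k; clear; lia.
- have := congr1 (size : {poly F} -> nat) Eq.
  rewrite size_polyDC ?sP // size_scale // mulrC size_Mmonic ?expf_neq0 //;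
    last by rewrite !rpredM ?monicX ?monicXsubC.
  rewrite !size_mul_XsubC ?mulf_neq0 ?polyXsubC_eq0 ?polyX_eq0 //.
  rewrite size_polyX size_sqr // En.
  by move: sq; move: (size q) => k; clear; lia.
have two0 : 2%:P != 0 :> {poly F} by rewrite polyC_eq0 pnatr_eq0.
apply: (mulfI two0); rewrite mulrBr.
have -> : monic_quartic z1 z2 z3 * q ^+ 2
    = 'X * ('X - z1%:P) * ('X - z2%:P) * ('X - z3%:P) * q ^+ 2 by [].
move: Ep Eq; rewrite e1 mulr1 mul1r -!mul_polyC => <- <-.
by rewrite polyCN polyC1 polyCMn polyC1; ring.
Qed.

(** For odd [n] the root [z2] moves from [P - 1] to [P + 1]: [P + 1 = -2 (X - z2) p^2] and
    [P - 1 = -2 X (X - z1) (X - z3) q^2], with [Q = 2 p q] backwards. *)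
Lemma pell_odd n m z1 z2 z3 :
    z1 != 0 -> 0 < z2 -> z1 != z2 -> z2 != z3 -> n = (2 * m + 1)%N ->
  (exists P Q, pell_at n z1 z2 z3 P Q) <->
  exists p q, [/\ size p = m.+1, size q = m, q != 0 &
    ('X - z2%:P) * p ^+ 2 - 'X * ('X - z1%:P) * ('X - z3%:P) * q ^+ 2 = -1].
Proof.
move=> z10 z20 z12 z23 En; have n0 : (0 < n)%N by rewrite En addn1.
split; last first.
  move=> [p [q [sp sq q0 e]]].
  have p0 : p != 0 by rewrite -size_poly_eq0 sp.
  exists (- 2%:R *: (p ^+ 2 * ('X - z2%:P)) + (-1)%:P), (2 *: (p * q)).
  have s2 : size (- 2%:R *: (p ^+ 2 * ('X - z2%:P))) = n.+1.
    rewrite size_scale ?oppr_eq0 ?pnatr_eq0 // size_mul_XsubC ?expf_neq0 //.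
    by rewrite size_sqr // sp En addn1.
  have evP z : ('X * ('X - z1%:P) * ('X - z3%:P)).[z] = 0 ->
      (- 2%:R *: (p ^+ 2 * ('X - z2%:P)) + (-1)%:P).[z] = 1.
    move=> wz; have := congr1 (fun r : {poly F} => r.[z]) e.
    rewrite /= hornerD hornerN hornerM horner_exp [X in _ - X]hornerM wz mul0r.
    rewrite subr0 hornerN hornerC => h.
    by rewrite hornerD hornerZ hornerM horner_exp hornerC [_ * (_ -
      _).[_]]mulrC h; ring.
  split.
  - by rewrite size_polyDC s2 // En addn1.
  - rewrite -!mul_polyC !polyCN polyC1.
    have {}e : 'X * ('X - z1%:P) * ('X - z3%:P) * q ^+ 2
      = ('X - z2%:P) * p ^+ 2 + 1 by rewrite -[1]opprK -e; ring.
    have -> : monic_quartic z1 z2 z3 * (2%:P * (p * q)) ^+ 2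
        = (2%:P) ^+ 2 * p ^+ 2 * ('X - z2%:P) *
          ('X * ('X - z1%:P) * ('X - z3%:P) * q ^+ 2).
      by rewrite /monic_quartic; ring.
    by rewrite e polyCMn polyC1; ring.
  - by apply: evP; rewrite !hornerM hornerX !mul0r.
  - by apply: evP; rewrite !hornerM !hornerXsubC subrr !(mulr0, mul0r).
  - rewrite hornerD hornerZ hornerM hornerXsubC subrr !mulr0 add0r hornerC.
    by rewrite En exprD exprM sqrrN expr1n expr1n mul1r expr1.
move=> [P [Q [sP pellP P0 P1 P2]]].
have m2 : 'X * ('X - z1%:P) \is @monic F.
  by rewrite !rpredM ?monicX ?monicXsubC.
have d1 : 'X - z2%:P %| P + 1%:P.
  rewrite dvdp_XsubCl /root hornerD hornerC P2 En exprD exprM sqrrN expr1n.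
  by rewrite expr1n mul1r expr1 addNr.
have [||v Ev] := @uniq_roots_prod_XsubC _ (P + (-1)%:P) [:: 0; z1].
- by rewrite /= /root !hornerD !hornerC P0 P1 subrr eqxx.
- by rewrite uniq_rootsE /= !inE eq_sym z10.
have d2 : 'X * ('X - z1%:P) %| P + (-1)%:P.
  by rewrite Ev !big_cons big_nil mulr1 polyC0 subr0 dvdp_mull.
have [||e [p [q [e2 Ep Eq p0 q0]]]] :=
    pell_squares (Q := Q) (z := z3) n0 sP (monicXsubC z2) m2 _ d1 d2.
- by rewrite size_XsubC En; clear; lia.
- by rewrite -[X in _ - X]pellP /monic_quartic; ring.
have e0 := sign_neq0 e2.
(* At 0 the factor ['X - z2%:P] is negative while [P + 1] is positive. *)
have e1 : e = -1.
  have := congr1 (fun r : {poly F} => r.[0]) Ep.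
  rewrite /= !hornerD hornerC P0 hornerZ hornerM hornerXsubC horner_exp => h.
  move/eqP: e2; rewrite sqrf_eq1 => /orP[/eqP e1|/eqP//].
  have h0 : 0 <= z2 * p.[0] ^+ 2 by rewrite mulr_ge0 ?sqr_ge0 ?ltW.
  exfalso; move: h h0; rewrite e1 sub0r mulNr.
  by move: (z2 * _) => k; lra.
exists p, q.
have sp : (0 < size p)%N by rewrite lt0n size_poly_eq0.
have sq : (0 < size q)%N by rewrite lt0n size_poly_eq0.
split=> //.
- have := congr1 (size : {poly F} -> nat) Ep.
  rewrite size_polyDC ?sP // size_scale // mulrC size_mul_XsubC ?expf_neq0 //.
  by rewrite size_sqr // En; move: sp; move: (size p) => k; clear; lia.
- have := congr1 (size : {poly F} -> nat) Eq.
  rewrite size_polyDC ?sP // size_scale // mulrC size_Mmonic ?expf_neq0 //;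
    last by rewrite !rpredM ?monicX ?monicXsubC.
  rewrite !size_mul_XsubC ?mulf_neq0 ?polyXsubC_eq0 ?polyX_eq0 //.
  rewrite size_polyX size_sqr // En.
  by move: sq; move: (size q) => k; clear; lia.
have two0 : 2%:P != 0 :> {poly F} by rewrite polyC_eq0 pnatr_eq0.
apply: (mulfI two0); rewrite mulrBr.
move: Ep Eq; rewrite e1 mulrN1 !scaleNr -!mul_polyC.
move=> /(congr1 -%R); rewrite opprK => <- /(congr1 -%R); rewrite opprK => <-.
by rewrite polyCN polyC1 polyCMn polyC1; ring.
Qed.


Lemma monic_quartic_monic z1 z2 z3 : monic_quartic z1 z2 z3 \is monic.
Proof. by rewrite !rpredM ?monicX ?monicXsubC. Qed.

Lemma size_monic_quartic z1 z2 z3 : size (monic_quartic z1 z2 z3) = 5.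
Proof.
rewrite /monic_quartic !size_mul_XsubC ?mulf_neq0 ?polyXsubC_eq0 ?polyX_eq0 //.
by rewrite size_polyX.
Qed.

(** Degrees and leading coefficients are compared in [P^2 - 1 = W Q^2], where [W] is a monic
    quartic. *)
Lemma pell_at_lead n z1 z2 z3 P Q : (0 < n)%N -> pell_at n z1 z2 z3 P Q ->
  [/\ (size Q).+1 = n, Q != 0 & lead_coef P ^+ 2 = lead_coef Q ^+ 2].
Proof.
move=> n0 [sP pellP _ _ _]; have P0 : P != 0 by rewrite -size_poly_eq0 sP.
have sP2 : size (P ^+ 2) = (2 * n).+1 by rewrite size_sqr // sP.
have n2 : (1 < size (P ^+ 2))%N by rewrite sP2 ltnS muln_gt0.
have E : P ^+ 2 + (-1)%:P = monic_quartic z1 z2 z3 * Q ^+ 2.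
  by rewrite polyCN polyC1 -[X in _ - X]pellP; ring.
have Q0 : Q != 0.
  apply/eqP => Q0; have := size_polyDC (-1) n2.
  by rewrite E Q0 expr0n mulr0 size_poly0 sP2.
split=> //.
- have := size_polyDC (-1) n2;
  rewrite E sP2 size_monicM ?monic_quartic_monic //;
    last by rewrite expf_neq0.
  rewrite size_monic_quartic size_sqr //.
  have : (0 < size Q)%N by rewrite lt0n size_poly_eq0.
  by move: (size Q) => k; clear; lia.
- rewrite -!lead_coef_exp -(lead_coefDC (-1) n2) E.
  by rewrite lead_coef_monicM ?monic_quartic_monic.
Qed.

End PellReduction.

(** * Transfer matrices *)

Section Matrix2.
Variable S : comNzRingType.
Implicit Types (x y z w : S) (A B : 'M[S]_2).

Definition mx2 x y z w : 'M[S]_2 :=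
  \matrix_(i, j) if i == 0 then if j == 0 then x else y
                 else if j == 0 then z else w.

Lemma mx2E A : A = mx2 (A 0 0) (A 0 1) (A 1 0) (A 1 1).
Proof.
apply/matrixP => i j; rewrite mxE.
case: i => [[|[|i]] Hi] //; case: j => [[|[|j]] Hj] //=;
  by congr (A _ _); apply: val_inj.
Qed.

Lemma mul_mx2 x y z w x' y' z' w' :
  mx2 x y z w * mx2 x' y' z' w' =
  mx2 (x * x' + y * z') (x * y' + y * w') (z * x' + w * z') (z * y' + w * w').
Proof.
apply/matrixP => i j; rewrite !mxE !big_ord_recl big_ord0 !mxE /= addr0.
by case: i => [[|[|i]] Hi] //; case: j => [[|[|j]] Hj].
Qed.

Lemma eq_mx2 x y z w x' y' z' w' :
  mx2 x y z w = mx2 x' y' z' w' -> [/\ x = x', y = y', z = z' & w = w'].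
Proof.
move=> /matrixP E; move: (E 0 0) (E 0 1) (E 1 0) (E 1 1).
by rewrite !mxE /= => -> -> -> ->.
Qed.

Lemma det_mx2 x y z w : \det (mx2 x y z w) = x * w - y * z.
Proof.
rewrite (expand_det_row _ 0) !big_ord_recl big_ord0 addr0 /cofactor !mxE /=.
by rewrite !det_mx11 !mxE /= expr0 expr1 mul1r mulN1r mulrN.
Qed.

End Matrix2.

Section LaxMatrix.
Variable F : realFieldType.
Implicit Types (p q : {poly F}) (A B : 'M[{poly F}]_2).

Definition quad (c2 c1 c0 : F) : {poly F} := c2%:P * 'X^2 + c1%:P * 'X + c0%:P.

Lemma coefMquad p c2 c1 c0 i :
  (p * quad c2 c1 c0)`_i.+2 = c2 * p`_i + c1 * p`_i.+1 + c0 * p`_i.+2.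
Proof.
rewrite /quad !mulrDr !(mulrA p) !coefD coefMXn coefMX coefMC /= subn2 !coefMC.
by rewrite /= !(mulrC _ p`_ _).
Qed.

Lemma coefM_top p q i j :
    (forall k, (i < k)%N -> p`_k = 0) -> (forall k, (j < k)%N -> q`_k = 0) ->
  (p * q)`_(i + j) = p`_i * q`_j.
Proof.
move=> hp hq; have lti : (i < (i + j).+1)%N by rewrite ltnS leq_addr.
rewrite coefM (bigD1 (Ordinal lti)) //= addKn big1 ?addr0 // => k /eqP neq_k.
have [/hp->|] := ltnP i k; first by rewrite mul0r.
rewrite leq_eqVlt => /orP[/eqP e|lt_k]; first by case: neq_k; apply: val_inj.
by rewrite hq ?mulr0 //; move: (val k) lt_k => l; clear; lia.
Qed.

(* Writing [lax] as mx2 (- f) e (- h) f, the symmetric matrix mx2 e f f h is the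
   Gram matrix of the confocal form with lambda = 1 / X on (A, 1) and (v, 0),
   times (a X - 1) (b X - 1). *)
Definition lax (eta kappa delta mu : F) : 'M[{poly F}]_2 :=
  mx2 (- quad kappa (- delta) 0) (quad 0 eta (-1))
      (- quad mu (-1) 0) (quad kappa (- delta) 0).

(* The flight (A, v) |-> (A + t v, v) followed by (A, v) |-> (A, v - c X A);
   at X = 1/a and X = 1/b the latter acts on the first, resp. second,
   coordinates as the reflection v |-> v - c N. *)
Definition transfer (t c : F) : 'M[{poly F}]_2 :=
  mx2 1 t%:P (- c%:P * 'X) (1 - (c * t)%:P * 'X).

Lemma det_transfer t c : \det (transfer t c) = 1.
Proof. by rewrite det_mx2 polyCM; ring. Qed.

(** The first three hypotheses are the effect of a bounce on the coefficients, [kappa] being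
    conserved. Each entry of the difference of the two products is a polynomial combination of
    [t * mu + 2 * kappa] and [c * eta' + 2 * kappa], which vanish. *)
Lemma lax_transfer eta kappa delta mu eta' delta' mu' t c :
    eta' = eta - 2 * t * delta - t ^+ 2 -> delta' = delta + t - c ->
    mu' = mu + 2 * c * (delta + t) - c ^+ 2 ->
    t * mu = - (2 * kappa) -> c * eta' = - (2 * kappa) ->
  lax eta' kappa delta' mu' * transfer t c =
  transfer t c * lax eta kappa delta mu.
Proof.
move=> eE dE mE /eqP; rewrite -addr_eq0 => /eqP k1 /eqP.
rewrite -addr_eq0 => /eqP k2.
have {}k1 : t%:P * mu%:P + 2 * kappa%:P = 0 :> {poly F}.
  by rewrite -polyCM -[2 * _]/(2%:R * _) -polyC_natr -polyCM -polyCD k1.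
have {}k2 : c%:P * eta'%:P + 2 * kappa%:P = 0 :> {poly F}.
  by rewrite -polyCM -[2 * _]/(2%:R * _) -polyC_natr -polyCM -polyCD k2.
have {}eE : eta%:P = eta'%:P + 2 * t%:P * delta%:P + t%:P ^+ 2 :> {poly F}.
  by rewrite eE !polyCB !polyCM polyC_natr; ring.
have {}mE : mu'%:P = mu%:P + 2 * c%:P * (delta%:P + t%:P) - c%:P ^+ 2 :> {poly
  F}.
  by rewrite mE polyCB polyCD !polyCM polyC_natr polyCD; ring.
rewrite /lax /transfer /quad !mul_mx2 eE dE mE.
rewrite !(polyCB, polyCM, polyCD, polyCN) polyC0 polyC1.
set k := kappa%:P in k1 k2 *; set e := eta'%:P in k1 k2 *.
set m := mu%:P in k1 k2 *; set u := t%:P in k1 k2 *; set w := c%:P in k1 k2 *.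
congr mx2; apply/eqP; rewrite -subr_eq0; apply/eqP.
- transitivity ((u * m + 2 * k - (w * e + 2 * k)) * 'X^2); first by ring.
  by rewrite k1 k2 subrr mul0r.
- transitivity (- u * 'X^2 * (w * e + 2 * k)); first by ring.
  by rewrite k2 mulr0.
- transitivity (- w * 'X^3 * (u * m + 2 * k)); first by ring.
  by rewrite k1 mulr0.
- transitivity ('X^2 * (w * e + 2 * k - (u * m + 2 * k))); first by ring.
  by rewrite k1 k2 subrr mulr0.
Qed.

(* The degree pattern of a product of [j] transfer matrices; it determines the
   upper left entry of a constant matrix only up to a scalar, whence [0 < i]. *)
Definition transfer_shape (j : nat) (A : 'M[{poly F}]_2) :=
  [/\ forall i, (j <= i)%N -> (0 < i)%N -> (A 0 0)`_i = 0,
      forall i, (j <= i)%N -> (A 0 1)`_i = 0,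
      forall i, (j < i)%N -> (A 1 0)`_i = 0,
      forall i, (j < i)%N -> (A 1 1)`_i = 0 & (A 1 1)`_j != 0].

(* Comparing leading coefficients in [\det A = 1] and in the second row of the
   intertwining relation shows that the last transfer matrix is forced. *)
Lemma transfer_shape_peel eta0 kappa delta0 mu0 eta delta mu eta' t c j A :
    kappa != 0 -> eta' = eta - 2 * t * delta - t ^+ 2 ->
    t * mu = - (2 * kappa) -> c * eta' = - (2 * kappa) ->
    A * lax eta kappa delta mu = lax eta0 kappa delta0 mu0 * A -> \det A = 1 ->
    transfer_shape j.+1 A ->
  exists2 B, A = B * transfer t c & transfer_shape j B.
Proof.
move=> k0 eE k1 k2.
rewrite (mx2E A); set a := A 0 0; set b := A 0 1; set x := A 1 0;
  set y := A 1 1.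
rewrite !mul_mx2 det_mx2 /transfer_shape !mxE /= => /eq_mx2[_ _ E21 E22] det1.
move=> [ha hb hx hy yj0].
have [l2 l3 l4] : [/\ j < j.+2, j < j.+3 & j.+1 < j.+3]%N by clear; split; lia.
(* [transfer t c] is a lower unipotent matrix (the kick) times an upper unipotent one (the flight).
   Multiplication of [A] on the right by the inverse flight gives the second column [b'], [y']. *)
pose b' := b - t%:P * a; pose y' := y - t%:P * x.
have m0 : mu != 0.
  by apply: contraNneq k0 => m0; move: k1; rewrite m0 mulr0 => k1; apply/eqP;
    lra.
(* The coefficient of degree [j + 3] of entry (1, 0) of the intertwining relation: the flight time
   [t] is the one that cancels the top term of [y']. *)
have yx : y`_j.+1 = t * x`_j.+1.
  have := congr1 (fun p : {poly F} => p`_j.+3) E21.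
  rewrite /= ![_ * - quad _ _ _]mulrN [- quad _ _ _ * _]mulrC [quad _ _ _ *
    _]mulrC.
  rewrite !mulrN !coefD !coefN !coefMquad.
  rewrite (ha j.+1) // (ha j.+2) // (ha j.+3) // (hx j.+2) // (hy j.+2) //.
  rewrite (hx j.+3) // (hy j.+3) //.
  move=> h; apply: (mulfI m0).
  have -> : mu * (t * x`_j.+1) = - (2 * kappa) * x`_j.+1 by rewrite -k1; ring.
  by lra.
have x0 : x`_j.+1 != 0 by move: yj0; rewrite yx mulf_eq0 negb_or => /andP[].
have hb' i : (j < i)%N -> b'`_i = 0.
  move=> ji; rewrite /b' coefB coefCM hb // ha ?mulr0 ?subr0 //.
  exact: leq_ltn_trans ji.
have hy' i : (j < i)%N -> y'`_i = 0.
  rewrite /y' coefB coefCM leq_eqVlt => /orP[/eqP <-|ji];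
    first by rewrite yx subrr.
  by rewrite hx ?hy // mulr0 subr0.
have det1' : a * y' - b' * x = 1 by rewrite -det1 /y' /b'; ring.
have a0 i : (j < i)%N -> a`_i = 0.
  by move=> ji; apply: ha => //; apply: leq_ltn_trans ji.
(* The term of degree [2 j + 1] in the determinant. *)
have b'0 : b'`_j = 0.
  have := congr1 (fun p : {poly F} => p`_(j + j.+1)) det1'.
  have z1 : (1 : {poly F})`_(j + j.+1) = 0 by rewrite coef1 addnS.
  rewrite /= coefB z1 !coefM_top // => [|k /ltnW]; last exact: hy'.
  rewrite hy' // mulr0 sub0r => /eqP.
  by rewrite oppr_eq0 mulf_eq0 (negPf x0) orbF => /eqP.
have hb'' i : (j <= i)%N -> b'`_i = 0.
  by rewrite leq_eqVlt => /orP[/eqP <-|/hb'].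
(* Entry (1, 1) of the intertwining relation after undoing the flight. The conjugated Lax matrix has
   no quadratic term in its upper right entry, because [2 t kappa + t^2 mu = 0]. *)
have E2 : x * quad 0 eta' (-1) + y' * quad (- kappa) (- delta - t) 0 =
    - (quad mu0 (-1) 0 * b') + quad kappa (- delta0) 0 * y'.
  have -> : quad 0 eta' (-1) = quad 0 eta (-1) + 2 * t%:P * quad kappa (-
    delta) 0
      + t%:P ^+ 2 * quad mu (-1) 0.
    apply/polyP => i; rewrite -polyC_natr -polyCM -polyC_exp !coefD !coefCM.
    rewrite !coefD !coefCM !coefXn !coefX !coefC eE.
    by case: i => [|[|[|i]]] /=; rewrite ?(mulr0, addr0) //;
      move: k1; nra.
  have -> : quad (- kappa) (- delta - t) 0 =
      quad kappa (- delta) 0 + t%:P * quad mu (-1) 0.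
    apply/polyP => i; rewrite !coefD !coefCM !coefD !coefCM !coefXn !coefX
      !coefC.
    by case: i => [|[|[|i]]] /=; rewrite ?(mulr0, addr0) //; lra.
  transitivity (x * quad 0 eta (-1) + y * quad kappa (- delta) 0
    - t%:P * (x * - quad kappa (- delta) 0 + y * - quad mu (-1) 0)).
    by rewrite /y'; ring.
  by rewrite E21 E22 /y' /b'; ring.
have yx' : eta' * x`_j.+1 = 2 * kappa * y'`_j.
  have E2j := congr1 (fun p : {poly F} => p`_j.+2) E2; move: E2j.
  rewrite /= [quad _ _ _ * b']mulrC [quad _ _ _ * y']mulrC.
  rewrite (coefD (x * _)) (coefD (- _)) coefN !coefMquad.
  rewrite b'0 (hb' j.+1) // (hb' j.+2) //.
  rewrite (hy' j.+1) // (hy' j.+2) // (hx j.+2) //.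
  by lra.
have xy : x`_j.+1 = - (c * y'`_j).
  apply: (mulfI k0); have : c * (eta' * x`_j.+1) = c * (2 * kappa * y'`_j).
    by rewrite yx'.
  by rewrite mulrA k2; lra.
have y'0 : y'`_j != 0.
  by apply: contraNneq x0 => y0; rewrite xy y0 mulr0 oppr0.
(* Undoing the kick as well; by [xy] this cancels the top term of the lower left entry. *)
exists (mx2 (a + c%:P * 'X * b') b' (x + c%:P * 'X * y') y').
  rewrite /transfer mul_mx2 polyCM /b' /y'.
  by congr mx2; ring.
rewrite /transfer_shape !mxE /=; split=> //.
- case=> // i ji _; rewrite -mulrA coefD coefCM coefXM /=.
  move: ji; rewrite leq_eqVlt => /orP[/eqP ji|ji]; last first.
    by rewrite a0 // hb'' ?mulr0 ?addr0.
  (* In the boundary degree [j = i + 1 > 0], the term of degree [2 j] in the determinant together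
     with [xy] gives [a_j + c b'_i = 0]. *)
  have e : (j + j = i + j.+1)%N by rewrite {1}ji addSnnS.
  have z1 : (1 : {poly F})`_(j + j) = 0 by rewrite coef1 ji.
  have := congr1 (fun p : {poly F} => p`_(j + j)) det1'.
  rewrite /= coefB z1 {2}e !coefM_top // => [|k ik]; last by rewrite hb'' // ji.
  rewrite xy -ji => h; apply: (mulIf y'0).
  by move: h; move: (y'`_j) => z; lra.
- case=> // i ji; rewrite -mulrA coefD coefCM coefXM /=.
  move: ji; rewrite ltnS leq_eqVlt => /orP[/eqP <-|ji];
    first by rewrite xy addNr.
  by rewrite hx ?hy' // mulr0 addr0.
Qed.


End LaxMatrix.

(** * The bounce *)

Section Dynamics.
Variables (R : realType) (a b : R).
Hypotheses (a0 : 0 < a) (b0 : 0 < b).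
Implicit Types (A B v : R * R) (t c : R).

(** For [A] on the ellipse and unit [v], the Gram matrix multiplied by [(a X - 1) (b X - 1)] has
    diagonal entries [eta X - 1] and [mu X^2 - X], and off-diagonal entry [kappa X^2 - delta X]. *)
Definition lax_eta A := a + b - A.1 ^+ 2 - A.2 ^+ 2.
Definition lax_kappa A v := b * A.1 * v.1 + a * A.2 * v.2.
Definition lax_delta A v := A.1 * v.1 + A.2 * v.2.
Definition lax_mu v := b * v.1 ^+ 2 + a * v.2 ^+ 2.

(** The root other than 0 of the equation in [on_ellipse_move]; it is positive when [lax_kappa] is
    negative, that is, when [v] points inwards. *)
Definition step_time A v := - (2 * lax_kappa A v) / lax_mu v.
Definition hit A v := move A v (step_time A v).
Definition step_pos A v := flip (hit A v).
Definition step_vel A v := flip (reflect_at a b (hit A v) v).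
(* The coefficient of the normal vector in [reflect_at]; the squared length of
   that vector is [lax_eta / (a * b)]. *)
Definition kick A v := - (2 * lax_kappa A v) / lax_eta (hit A v).

Lemma on_ellipseE A :
  on_ellipse a b A <-> b * A.1 ^+ 2 + a * A.2 ^+ 2 = a * b.
Proof.
have [an bn] : a != 0 /\ b != 0 by rewrite !gt_eqF.
have E : A.1 ^+ 2 / a + A.2 ^+ 2 / b = (b * A.1 ^+ 2 + a * A.2 ^+ 2) / (a * b).
  by field; rewrite an bn.
have ab0 : a * b != 0 by rewrite mulf_neq0.
rewrite /on_ellipse E; split=> [/(canRL (divfK ab0))|->];
  first by rewrite mul1r.
by rewrite divff.
Qed.

Lemma lax_mu_gt0 v : v.1 ^+ 2 + v.2 ^+ 2 = 1 -> 0 < lax_mu v.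
Proof.
rewrite /lax_mu => nv; have [v10|v10] := eqVneq (v.1 ^+ 2) 0.
  by move: nv; rewrite v10 add0r => ->; rewrite mulr0 mulr1 add0r.
apply: ltr_pwDl; first by rewrite mulr_gt0 // lt0r v10 sqr_ge0.
by rewrite mulr_ge0 ?sqr_ge0 // ltW.
Qed.

Lemma lax_eta_sqr_normal A : on_ellipse a b A ->
  (A.1 / a) ^+ 2 + (A.2 / b) ^+ 2 = lax_eta A / (a * b).
Proof.
have [an bn] : a != 0 /\ b != 0 by rewrite !gt_eqF.
move=> /on_ellipseE E.
have -> : (A.1 / a) ^+ 2 + (A.2 / b) ^+ 2 =
    (b ^+ 2 * A.1 ^+ 2 + a ^+ 2 * A.2 ^+ 2) / (a * b) / (a * b).
  by field; rewrite an bn.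
congr (_ / _); apply: (canLR (mulfK _)); first by rewrite mulf_neq0.
rewrite /lax_eta; transitivity ((a + b) * (a * b) - a * b * (A.1 ^+ 2 + A.2 ^+
  2)); last by ring.
by rewrite -{1}E; ring.
Qed.

Lemma lax_eta_gt0 A : on_ellipse a b A -> 0 < lax_eta A.
Proof.
move=> E; have := lax_eta_sqr_normal E;
  have [an bn] : a != 0 /\ b != 0 by rewrite !gt_eqF.
have : 0 < (A.1 / a) ^+ 2 + (A.2 / b) ^+ 2.
  rewrite lt0r addr_ge0 ?sqr_ge0 // andbT paddr_eq0 ?sqr_ge0 // !sqrf_eq0.
  rewrite !mulf_eq0 !invr_eq0 (negPf an) (negPf bn) !orbF.
  apply/negP => /andP[/eqP A1 /eqP A2]; move: E; rewrite /on_ellipse A1 A2.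
  by rewrite expr0n /= !mul0r addr0 => /eqP; rewrite eq_sym oner_eq0.
by move=> h e; move: h; rewrite e pmulr_lgt0 // invr_gt0 mulr_gt0.
Qed.

Lemma on_ellipse_move A v t : on_ellipse a b A ->
  on_ellipse a b (move A v t) <-> t * (2 * lax_kappa A v + t * lax_mu v) = 0.
Proof.
move=> /on_ellipseE E; rewrite on_ellipseE.
have -> : b * (move A v t).1 ^+ 2 + a * (move A v t).2 ^+ 2 =
    b * A.1 ^+ 2 + a * A.2 ^+ 2 + t * (2 * lax_kappa A v + t * lax_mu v).
  by rewrite /lax_kappa /lax_mu /=; ring.
rewrite E; split=> [h|->]; last by rewrite addr0.
by apply: (addrI (a * b)); rewrite h addr0.
Qed.

(** Makes the bounce a function: as [lax_mu] is positive, a positive hitting time exists exactly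
    when [lax_kappa] is negative, and it is then [step_time]. *)
Lemma magic_stepE A v A' v' : on_ellipse a b A -> v.1 ^+ 2 + v.2 ^+ 2 = 1 ->
  magic_step a b A v A' v' <->
  [/\ lax_kappa A v < 0, A' = step_pos A v & v' = step_vel A v].
Proof.
move=> EA nv; have mu0 := lax_mu_gt0 nv.
split=> [[t [t0 /on_ellipse_move E -> ->]]|[k0 -> ->]].
  have {}E : 2 * lax_kappa A v + t * lax_mu v = 0.
    by move: (E EA) => /eqP; rewrite mulf_eq0 gt_eqF //= => /eqP.
  have tE : t = step_time A v.
    rewrite /step_time; apply: (canRL (mulfK _)); first by rewrite gt_eqF.
    by move: E; lra.
  split; rewrite ?tE //; have : 0 < t * lax_mu v by rewrite mulr_gt0.
  by move: E; lra.
exists (step_time A v); split=> //.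
- by rewrite /step_time divr_gt0 // oppr_gt0 pmulr_rlt0.
- apply/on_ellipse_move => //.
  by rewrite /step_time divfK ?gt_eqF // subrr mulr0.
Qed.

Section Step.
Variables (A v : R * R).
Hypotheses (EA : on_ellipse a b A) (nv : v.1 ^+ 2 + v.2 ^+ 2 = 1).
Let t := step_time A v.
Let c := kick A v.

Lemma on_ellipse_hit : on_ellipse a b (hit A v).
Proof.
apply/on_ellipse_move => //.
by rewrite /step_time divfK ?gt_eqF ?lax_mu_gt0 // subrr mulr0.
Qed.

Lemma step_timeE : t * lax_mu v = - (2 * lax_kappa A v).
Proof. by rewrite /t /step_time divfK // gt_eqF // lax_mu_gt0. Qed.

Lemma kickE : c * lax_eta (hit A v) = - (2 * lax_kappa A v).
Proof. by rewrite /c /kick divfK // gt_eqF // lax_eta_gt0 //;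
  apply: on_ellipse_hit. Qed.

(** [lax_kappa] is half the derivative along the chord of the quadratic form [b x^2 + a y^2], hence
    opposite at the two ends. *)
Lemma lax_kappa_hit : lax_kappa (hit A v) v = - lax_kappa A v.
Proof.
have -> : lax_kappa (hit A v) v = lax_kappa A v + t * lax_mu v.
  by rewrite /lax_kappa /lax_mu /hit /t /=; ring.
by rewrite step_timeE; ring.
Qed.

Lemma reflect_hit : reflect_at a b (hit A v) v =
  (v.1 - c * ((hit A v).1 / a), v.2 - c * ((hit A v).2 / b)).
Proof.
have [an bn] : a != 0 /\ b != 0 by rewrite !gt_eqF.
have := lax_kappa_hit; have EB := on_ellipse_hit; rewrite /c /kick.
move: (hit A v) EB => B EB kB; rewrite /reflect_at /= lax_eta_sqr_normal //.
suff -> : 2 * (v.1 * (B.1 / a) + v.2 * (B.2 / b)) / (lax_eta B / (a * b))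
    = - (2 * lax_kappa A v) / lax_eta B by [].
have -> : v.1 * (B.1 / a) + v.2 * (B.2 / b) = lax_kappa B v / (a * b).
  by rewrite /lax_kappa; field; rewrite an bn.
rewrite kB; field.
by rewrite an bn gt_eqF // lax_eta_gt0.
Qed.

Lemma step_posE : step_pos A v = (A.1 + t * v.1, - (A.2 + t * v.2)).
Proof. by []. Qed.

Lemma step_velE : step_vel A v =
  (v.1 - c / a * (step_pos A v).1, - v.2 - c / b * (step_pos A v).2).
Proof.
rewrite /step_vel /flip reflect_hit /=.
by congr (_, _); ring.
Qed.

Lemma on_ellipse_step : on_ellipse a b (step_pos A v).
Proof. by have := on_ellipse_hit; rewrite /on_ellipse /= sqrrN. Qed.

Lemma lax_eta_step :
  lax_eta (step_pos A v) = lax_eta A - 2 * t * lax_delta A v - t ^+ 2.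
Proof.
rewrite /lax_eta /lax_delta step_posE /=.
have -> : A.1 ^+ 2 = A.1 ^+ 2 + t ^+ 2 * (v.1 ^+ 2 + v.2 ^+ 2 - 1)
  by rewrite nv; ring.
by ring.
Qed.

Lemma kick_etaE : c * lax_eta (step_pos A v) = - (2 * lax_kappa A v).
Proof. by rewrite -kickE /lax_eta /= sqrrN. Qed.

(** Joachimsthal's integral: the chord reverses the sign, the reflection reverses it again, and the
    flip has no effect. *)
Lemma lax_kappa_step : lax_kappa (step_pos A v) (step_vel A v) = lax_kappa A v.
Proof.
have -> : lax_kappa A v = - lax_kappa A v - c * lax_eta (step_pos A v).
  by rewrite kick_etaE; ring.
rewrite -lax_kappa_hit.
have -> : lax_eta (step_pos A v) =
    a * b * (((step_pos A v).1 / a) ^+ 2 + ((step_pos A v).2 / b) ^+ 2).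
  rewrite lax_eta_sqr_normal; last exact: on_ellipse_step.
  by rewrite mulrCA divff ?mulr1 // mulf_neq0 // gt_eqF.
rewrite /lax_kappa step_velE /=; field.
by rewrite !gt_eqF.
Qed.

Lemma lax_delta_step :
  lax_delta (step_pos A v) (step_vel A v) = lax_delta A v + t - c.
Proof.
have -> : lax_delta A v + t - c = lax_delta A v + t * (v.1 ^+ 2 + v.2 ^+ 2)
    - c * ((step_pos A v).1 ^+ 2 / a + (step_pos A v).2 ^+ 2 / b).
  by rewrite nv on_ellipse_step; ring.
rewrite /lax_delta step_velE /t /=; field.
by rewrite !gt_eqF.
Qed.

Lemma norm_step : (step_vel A v).1 ^+ 2 + (step_vel A v).2 ^+ 2 = 1.
Proof.
have [an bn] : a != 0 /\ b != 0 by rewrite !gt_eqF.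
rewrite step_velE /=.
transitivity (v.1 ^+ 2 + v.2 ^+ 2 - 2 * c / (a * b) * lax_kappa (hit A v) v
    + c ^+ 2 * (((step_pos A v).1 / a) ^+ 2 + ((step_pos A v).2 / b) ^+ 2)).
  by rewrite /lax_kappa /=; field; rewrite an bn.
rewrite nv lax_kappa_hit lax_eta_sqr_normal; last exact: on_ellipse_step.
transitivity (1 + c / (a * b) * (2 * lax_kappa A v + c * lax_eta (step_pos A
  v))).
  by field; rewrite an bn.
by rewrite kick_etaE; ring.
Qed.

Lemma lax_mu_step :
  lax_mu (step_vel A v) = lax_mu v + 2 * c * (lax_delta A v + t) - c ^+ 2.
Proof.
(* For unit vectors [lax_mu] takes a form in which the kick, with components divided by [a] and [b],
   produces the left side of the ellipse equation. *)
have muE w : w.1 ^+ 2 + w.2 ^+ 2 = 1 ->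
  lax_mu w = a + b - a * w.1 ^+ 2 - b * w.2 ^+ 2.
  move=> nw; rewrite -[a + b]mulr1 -nw /lax_mu; ring.
rewrite !muE ?norm_step // step_velE /=.
have -> : c ^+ 2 = c ^+ 2 * ((step_pos A v).1 ^+ 2 / a + (step_pos A v).2 ^+ 2
  / b).
  by rewrite on_ellipse_step mulr1.
have -> : t = t * (v.1 ^+ 2 + v.2 ^+ 2) by rewrite nv mulr1.
rewrite /lax_delta /= -/t; field.
by rewrite !gt_eqF.
Qed.

End Step.

End Dynamics.

(** * The caustic *)

Section Caustic.
Variables (R : realType) (a b : R).
Hypotheses (a0 : 0 < a) (b0 : 0 < b).
Implicit Types (A v : R * R) (beta : R).

(** The root [lambda] of the tangency condition [(a - lambda) v2^2 + (b - lambda) v1^2 = (A1 v2 - A2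
    v1)^2], which is linear in [lambda] with coefficient [-1] for a unit vector. *)
Definition caustic_param A v := lax_mu a b v - (A.1 * v.2 - A.2 * v.1) ^+ 2.

Lemma tangent_confocalE beta A v :
    a != beta -> b != beta -> v.1 ^+ 2 + v.2 ^+ 2 = 1 ->
  tangent_confocal a b beta A v <-> caustic_param A v = beta.
Proof.
rewrite -[a == _]subr_eq0 -[b == _]subr_eq0 => ab bb nv.
have cE : caustic_param A v - beta = (a - beta) * v.2 ^+ 2 +
    (b - beta) * v.1 ^+ 2 - (A.1 * v.2 - A.2 * v.1) ^+ 2.
  by rewrite -[X in _ - X = _]mulr1 -nv /caustic_param /lax_mu; ring.
split.
  move=> [[[p1 p2] p3] [P0]]; rewrite /confocal_form /= !mulr0 mulr1 subr0.
  pose u := p1 / (a - beta); pose w := p2 / (b - beta).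
  have p1E : p1 = u * (a - beta) by rewrite divfK.
  have p2E : p2 = w * (b - beta) by rewrite divfK.
  have -> : p1 * p1 / (a - beta) = u ^+ 2 * (a - beta) by rewrite p1E; field.
  have -> : p2 * p2 / (b - beta) = w ^+ 2 * (b - beta) by rewrite p2E; field.
  have -> : p1 * A.1 / (a - beta) = u * A.1 by rewrite p1E; field.
  have -> : p2 * A.2 / (b - beta) = w * A.2 by rewrite p2E; field.
  have -> : p1 * v.1 / (a - beta) = u * v.1 by rewrite p1E; field.
  have -> : p2 * v.2 / (b - beta) = w * v.2 by rewrite p2E; field.
  (* The covector [(u, w)] annihilates [v], so it is [k] times [v] turned by a right angle; the
     incidence with [A] then gives [p3], and the conic equation becomes [k^2] times the tangency
     condition. *)
  move=> EPP EPA EPv; pose k := w * v.1 - u * v.2.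
  have uE : u = - (k * v.2).
    rewrite -[LHS]mulr1 -nv /k.
    have -> : u * (v.1 ^+ 2 + v.2 ^+ 2) = v.1 * (u * v.1 + w * v.2) - (w * v.1
      - u * v.2) * v.2 by ring.
    by rewrite EPv mulr0 sub0r.
  have wE : w = k * v.1.
    rewrite -[LHS]mulr1 -nv /k.
    have -> : w * (v.1 ^+ 2 + v.2 ^+ 2) = v.2 * (u * v.1 + w * v.2) + (w * v.1
      - u * v.2) * v.1 by ring.
    by rewrite EPv mulr0 add0r.
  have p3E : p3 = - k * (A.1 * v.2 - A.2 * v.1).
    by apply/eqP; rewrite -subr_eq0; apply/eqP;
      rewrite -[RHS]oppr0 -EPA uE wE; ring.
  have k0 : k != 0.
    apply/eqP => k0; apply: P0.
    by rewrite p1E p2E p3E uE wE k0 !(mul0r, oppr0).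
  apply/eqP; rewrite -subr_eq0 cE -(mulrI_eq0 _ (mulfI (expf_neq0 2 k0))).
  by rewrite -EPP uE wE p3E; apply/eqP; ring.
(* The pole of the line, from the formulas above with [k = 1]. *)
move=> E; exists (- v.2 * (a - beta), v.1 * (b - beta), - (A.1 * v.2 - A.2 *
  v.1)).
rewrite /confocal_form /=; split.
- case=> /eqP; rewrite mulf_eq0 oppr_eq0 (negPf ab) orbF => /eqP v2 /eqP.
  rewrite mulf_eq0 (negPf bb) orbF => /eqP v1 _; move: nv.
  by rewrite v1 v2 expr0n add0r => /eqP; rewrite eq_sym oner_eq0.
- move: E => /eqP; rewrite -subr_eq0 cE => /eqP <-; field.
  by rewrite ab bb.
- by field; rewrite ab bb.
- by field; rewrite ab bb.
Qed.

(** Lagrange's identity for the form [b x^2 + a y^2], whose value at [A] is [a * b]. *)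
Lemma lax_kappa_sqr A v : on_ellipse a b A ->
  lax_kappa a b A v ^+ 2 = a * b * caustic_param A v.
Proof.
move=> /(on_ellipseE a0 b0) E; rewrite /caustic_param mulrBr -{1}E.
by rewrite /lax_kappa /lax_mu; ring.
Qed.

(** The left side is minus the determinant of the Lax matrix. Both sides are quartics with terms of
    degree 0 and 1 equal to [- X]; [e2], [e3] and [e4] match the coefficients of degree 2, 3 and
    4. *)
Lemma lax_spectral A v beta : on_ellipse a b A -> v.1 ^+ 2 + v.2 ^+ 2 = 1 ->
    beta != 0 -> caustic_param A v = beta ->
  quad (lax_kappa a b A v) (- lax_delta A v) 0 ^+ 2 -
    quad 0 (lax_eta a b A) (-1) * quad (lax_mu a b v) (-1) 0 =
  (a * b * beta)%:P * monic_quartic a^-1 b^-1 beta^-1.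
Proof.
move=> EA nv bn E; have := lax_kappa_sqr v EA; rewrite E => e4.
have {}EA := (on_ellipseE a0 b0 A).1 EA.
have e3 : 2 * lax_kappa a b A v * lax_delta A v + lax_eta a b A * lax_mu a b v =
    a * b + (a + b) * beta.
  apply/eqP; rewrite -subr_eq0; apply/eqP.
  transitivity ((b * A.1 ^+ 2 + a * A.2 ^+ 2 - a * b) * (v.1 ^+ 2 + v.2 ^+ 2)
     + a * b * (v.1 ^+ 2 + v.2 ^+ 2 - 1)).
    by rewrite -E /caustic_param /lax_kappa /lax_delta /lax_eta /lax_mu; ring.
  by rewrite EA nv !subrr; ring.
have e2 : lax_delta A v ^+ 2 + lax_eta a b A + lax_mu a b v = a + b + beta.
  apply/eqP; rewrite -subr_eq0; apply/eqP.
  transitivity ((A.1 ^+ 2 + A.2 ^+ 2) * (v.1 ^+ 2 + v.2 ^+ 2 - 1)).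
    by rewrite -E /caustic_param /lax_delta /lax_eta /lax_mu; ring.
  by rewrite nv subrr mulr0.
have [an bn'] : a != 0 /\ b != 0 by rewrite !gt_eqF.
have inv z : z != 0 -> z%:P * ('X - (z^-1)%:P) = z%:P * 'X - 1 :> {poly R}.
  by move=> z0; rewrite mulrBr -polyCM divff.
have -> : (a * b * beta)%:P * monic_quartic a^-1 b^-1 beta^-1 =
    'X * (a%:P * 'X - 1) * (b%:P * 'X - 1) * (beta%:P * 'X - 1).
  by rewrite -!inv // /monic_quartic !polyCM; ring.
move: e2 e3 e4; rewrite /quad; move: (lax_kappa _ _ _ _) (lax_delta _ _) => k d.
move: (lax_eta _ _ _) (lax_mu _ _ _) => e m.
move=> /(congr1 (@polyC R)); rewrite !polyCD polyC_exp => e2.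
move=> /(congr1 (@polyC R)); rewrite !(polyCD, polyCM) => e3.
move=> /(congr1 (@polyC R)); rewrite polyC_exp !polyCM => e4.
rewrite polyCN polyC0 polyCN polyC1.
transitivity (k%:P ^+ 2 * 'X^4 - (((1%:P + 1%:P) * k%:P * d%:P + e%:P * m%:P))
  * 'X^3
  + (d%:P ^+ 2 + e%:P + m%:P) * 'X^2 - 'X); first by rewrite polyC1; ring.
by rewrite e2 e3 e4; ring.
Qed.

End Caustic.

(** * Evaluation of polynomial matrices and products of transfer matrices *)

Section Act.
Variable F : comNzRingType.
Implicit Types (A B : 'M[{poly F}]_2) (z : F) (u : F * F).

Definition eval_act z A u : F * F :=
  ((A 0 0).[z] * u.1 + (A 0 1).[z] * u.2, (A 1 0).[z] * u.1 + (A 1 1).[z] *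
    u.2).

Lemma eval_actM z A B u : eval_act z (A * B) u = eval_act z A (eval_act z B u).
Proof.
rewrite (mx2E A) (mx2E B) mul_mx2 /eval_act !mxE /= !hornerD !hornerM.
by congr (_, _); ring.
Qed.

Lemma eval_act1 z u : eval_act z 1 u = u.
Proof.
case: u => u1 u2; rewrite /eval_act !mxE /= hornerC horner0.
by rewrite !mul1r !mul0r addr0 add0r.
Qed.

End Act.

Section Products.
Variable F : realFieldType.
Variables t c : nat -> F.

Fixpoint transfer_prod n : 'M[{poly F}]_2 :=
  if n is k.+1 then transfer (t k) (c k) * transfer_prod k else 1.

Lemma det_transfer_prod n : \det (transfer_prod n) = 1.
Proof. by elim: n => [|n IHn] /=;
  rewrite ?det1 // det_mulmx det_transfer mul1r. Qed.

(** At [X = 0] every kick is trivial and the flights compose to a shear. This normalization later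
    excludes other constant factors. *)
Lemma transfer_prod0 n : exists s, forall u,
  eval_act 0 (transfer_prod n) u = (u.1 + s * u.2, u.2).
Proof.
elim: n => [|n [s IHn]].
  by exists 0 => -[u1 u2]; rewrite eval_act1 mul0r addr0.
exists (s + t n) => u; rewrite /= eval_actM IHn /eval_act !mxE /=.
rewrite !hornerE; congr (_, _); ring.
Qed.

(** Each factor multiplies the top coefficient of the lower right entry by [- c t]. *)
Lemma transfer_prod_shape n :
  (forall k, t k != 0) -> (forall k, c k != 0) ->
    transfer_shape n (transfer_prod n).
Proof.
move=> t0 c0; elim: n => [|n [h00 h01 h10 h11 h]].
  rewrite /transfer_shape /= !mxE /=; split=> [i _|i _|i|i|];
    rewrite ?coef0 ?coef1 //.
  - by case: i.
  - by case: i.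
  - by rewrite oner_eq0.
rewrite /= (mx2E (transfer_prod n)) mul_mx2 /transfer_shape !mxE /=.
move: h00 h01 h10 h11 h; set x := _ 0 0; set y := _ 0 1; set z := _ 1 0;
  set w := _ 1 1.
move=> h00 h01 h10 h11 h; split.
- by move=> i ni i0; rewrite mul1r coefD coefCM h00 ?(ltnW ni) // h10 //
  mulr0 addr0.
- by move=> i ni; rewrite mul1r coefD coefCM h01 ?(ltnW ni) // h11 //
  mulr0 addr0.
- case=> // i; rewrite ltnS => ni; have ni' := ltnW ni.
  have i0 : (0 < i)%N by apply: leq_ltn_trans ni.
  rewrite mulrBl mul1r -!mulrA coefD coefB -polyCN !coefCM !coefXM /=.
  rewrite (h10 i) // (h10 i.+1) 1?ltnW // (h00 i) //.
  by rewrite !mulr0 subrr addr0.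
- case=> // i; rewrite ltnS => ni; have ni' := ltnW ni.
  have i0 : (0 < i)%N by apply: leq_ltn_trans ni.
  rewrite mulrBl mul1r -!mulrA coefD coefB -polyCN !coefCM !coefXM /=.
  rewrite (h11 i) // (h11 i.+1) 1?ltnW // (h01 i) //.
  by rewrite !mulr0 subrr addr0.
- rewrite mulrBl mul1r -!mulrA coefD coefB -polyCN !coefCM !coefXM /=.
  by rewrite h01 // h11 // mulr0 add0r sub0r oppr_eq0 !mulf_neq0.
Qed.

End Products.

(** * The commutant of the Lax matrix *)

Section Pencil.
Variable F : realFieldType.
Variables eta kappa delta mu : F.
Implicit Types (P g : {poly F}).
Let f := quad kappa (- delta) 0.
Let e := quad 0 eta (-1).
Let h := quad mu (-1) 0.

Lemma horner_quad (c2 c1 c0 z : F) : (quad c2 c1 c0).[z] = c2 * z ^+ 2 + c1 *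
  z + c0.
Proof. by rewrite /quad !hornerD [X in X + _ + _]hornerM hornerXn hornerM
  !hornerC hornerX. Qed.

(** This is [P + g L] with [L] the matrix [lax eta kappa delta mu]. *)
Definition pencil P g : 'M[{poly F}]_2 :=
  mx2 (P - g * f) (g * e) (- (g * h)) (P + g * f).

Lemma det_pencil P g : \det (pencil P g) = P ^+ 2 - (f ^+ 2 - e * h) * g ^+ 2.
Proof. by rewrite det_mx2; ring. Qed.

Lemma pencil_comm P g :
  pencil P g * lax eta kappa delta mu = lax eta kappa delta mu * pencil P g.
Proof. by rewrite !mul_mx2; congr mx2; rewrite -/f -/e -/h; ring. Qed.

Lemma eval_pencil P g z u :
  eval_act z (lax eta kappa delta mu) u = (0, 0) ->
  eval_act z (pencil P g) u = (P.[z] * u.1, P.[z] * u.2).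
Proof.
rewrite /eval_act !mxE /= -/f -/e -/h; move: f e h => f' e' h'.
rewrite !(hornerD, hornerN, hornerM) => -[E1 E2]; congr (_, _).
  by rewrite -[RHS]addr0 -(mulr0 g.[z]) -E1; ring.
by rewrite -[RHS]addr0 -(mulr0 g.[z]) -E2; ring.
Qed.

Lemma pencil0 P g : P.[0] = 1 ->
  exists s, forall u, eval_act 0 (pencil P g) u = (u.1 + s * u.2, u.2).
Proof.
move=> P0; exists (g.[0] * e.[0]) => u.
have f0 : f.[0] = 0 by rewrite horner_quad; ring.
have h0 : h.[0] = 0 by rewrite horner_quad; ring.
rewrite /eval_act !mxE /= -/f -/e -/h; move: f e h f0 h0 => f' e' h' f0 h0.
by rewrite !(hornerD, hornerN, hornerM) f0 h0 P0; congr (_, _); ring.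
Qed.

(** Over the fraction field the commutant of [L] is spanned by 1 and [L]. The coefficient of [L] is
    [A 0 1] divided by [e]; it is a polynomial because [h] does not vanish at the root [eta^-1] of
    [e] when [mu != eta], so [E11] makes this a root of [A 0 1]. *)
Lemma comm_pencil (A : 'M[{poly F}]_2) : eta != 0 -> mu != eta ->
    A * lax eta kappa delta mu = lax eta kappa delta mu * A ->
  exists g, A = pencil (2^-1 *: (A 0 0 + A 1 1)) g.
Proof.
move=> eta0 mue; rewrite {1 2}(mx2E A) !mul_mx2 -/f -/e -/h =>
  /eq_mx2[E11 E12 E21 _].
have eE : e = eta *: ('X - (eta^-1)%:P).
  rewrite -mul_polyC mulrBr -polyCM divff // /e /quad polyCN !polyC0 polyC1.
  by ring.
have : root (A 0 1) eta^-1.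
  have h0 : h.[eta^-1] != 0.
    rewrite horner_quad addr0 expr2 mulrA -mulrDl mulf_neq0 ?invr_eq0 //.
    rewrite subr_eq0; apply: contraNneq mue => e1.
    by rewrite -[mu](divfK eta0) e1 mul1r.
  have er : e.[eta^-1] = 0 by rewrite eE hornerZ hornerXsubC subrr mulr0.
  move: E11 er h0; clear; move: f e h => f' e' h' E11 er h0.
  have /eqP := congr1 (fun p : {poly F} => p.[eta^-1]) E11.
  rewrite /= !(hornerD, hornerN, hornerM) er mul0r addr0 mulrN mulNr mulrC.
  by rewrite -subr_eq0 addrAC subrr add0r mulrN oppr_eq0 mulf_eq0 (negPf h0)
    orbF.
move=> /factor_theorem[q Eq]; pose g := eta^-1 *: q.
have B : A 0 1 = g * e.
  by rewrite Eq eE -scalerAl -scalerAr scalerA mulVf ?scale1r.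
have e0 : e != 0 by rewrite eE scaler_eq0 negb_or eta0 polyXsubC_eq0.
have C : A 1 0 = - (g * h).
  apply: (mulfI e0); move: E11; rewrite B => E11.
  transitivity (- f * A 0 0 + e * A 1 0 + f * A 0 0); first by ring.
  by rewrite -E11; ring.
have DA : A 1 1 - A 0 0 = 2 * (g * f).
  apply: (mulfI e0); move: E12; rewrite B => E12.
  transitivity (- f * (g * e) + e * A 1 1 + f * (g * e) - e * A 0 0);
    first by ring.
  by rewrite -E12; ring.
exists g; rewrite {1}(mx2E A) /pencil -/f -/e -/h -B -C.
have half (x y : {poly F}) : x = 2^-1 *: (2 * x).
  by rewrite -polyC_natr mul_polyC scalerA mulVf ?scale1r ?pnatr_eq0.
by congr mx2; rewrite [g * f]half // -DA -?scalerBr -?scalerDr [LHS]half //;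
  congr (_ *: _); ring.
Qed.

End Pencil.

(** * Trajectories *)

Section Trajectory.
Variables (R : realType) (a b : R).
Hypotheses (a0 : 0 < a) (b0 : 0 < b).
Implicit Types (A v : R * R).

Definition lax_at A v : 'M[{poly R}]_2 :=
  lax (lax_eta a b A) (lax_kappa a b A v) (lax_delta A v) (lax_mu a b v).

Lemma eval_lax_at z A v u w :
  eval_act z (lax_at A v) (u, w) =
  (- (lax_kappa a b A v * z ^+ 2 - lax_delta A v * z) * u
     + (lax_eta a b A * z - 1) * w,
   - (lax_mu a b v * z ^+ 2 - z) * u
     + (lax_kappa a b A v * z ^+ 2 - lax_delta A v * z) * w).
Proof.
rewrite /eval_act !mxE /= !hornerN !horner_quad.
by congr (_, _); ring.
Qed.

(** At [X = 1/a] the Gram matrix keeps only the first coordinates: [L] is [(b - a) / a^2] times the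
    matrix with rows [(- A1 v1, A1^2)] and [(- v1^2, A1 v1)]. *)
Lemma eval_lax_at_a A v : on_ellipse a b A -> v.1 ^+ 2 + v.2 ^+ 2 = 1 ->
  eval_act a^-1 (lax_at A v) (A.1, v.1) = (0, 0).
Proof.
have an : a != 0 by rewrite gt_eqF.
move=> /(on_ellipseE a0 b0) E nv; rewrite eval_lax_at.
have -> : lax_kappa a b A v * a^-1 ^+ 2 - lax_delta A v * a^-1 =
    (b - a) * A.1 * v.1 / a ^+ 2.
  by rewrite /lax_kappa /lax_delta; field.
have -> : lax_eta a b A * a^-1 - 1 = (b - a) * A.1 ^+ 2 / a ^+ 2.
  have -> : (b - a) * A.1 ^+ 2 = a * lax_eta a b A - a ^+ 2.
    transitivity (a * lax_eta a b A - a ^+ 2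
      + (b * A.1 ^+ 2 + a * A.2 ^+ 2 - a * b)); last by rewrite E subrr addr0.
    by rewrite /lax_eta; ring.
  by field.
have -> : lax_mu a b v * a^-1 ^+ 2 - a^-1 = (b - a) * v.1 ^+ 2 / a ^+ 2.
  by rewrite -[a^-1 in X in _ - X]mulr1 -nv /lax_mu; field.
by congr (_, _); ring.
Qed.

Lemma eval_lax_at_b A v : on_ellipse a b A -> v.1 ^+ 2 + v.2 ^+ 2 = 1 ->
  eval_act b^-1 (lax_at A v) (A.2, v.2) = (0, 0).
Proof.
have bn : b != 0 by rewrite gt_eqF.
move=> /(on_ellipseE a0 b0) E nv; rewrite eval_lax_at.
have -> : lax_kappa a b A v * b^-1 ^+ 2 - lax_delta A v * b^-1 =
    (a - b) * A.2 * v.2 / b ^+ 2.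
  by rewrite /lax_kappa /lax_delta; field.
have -> : lax_eta a b A * b^-1 - 1 = (a - b) * A.2 ^+ 2 / b ^+ 2.
  have -> : (a - b) * A.2 ^+ 2 = b * lax_eta a b A - b ^+ 2.
    transitivity (b * lax_eta a b A - b ^+ 2
      + (b * A.1 ^+ 2 + a * A.2 ^+ 2 - a * b)); last by rewrite E subrr addr0.
    by rewrite /lax_eta; ring.
  by field.
have -> : lax_mu a b v * b^-1 ^+ 2 - b^-1 = (a - b) * v.2 ^+ 2 / b ^+ 2.
  by rewrite -[b^-1 in X in _ - X]mulr1 -nv /lax_mu; field.
by congr (_, _); ring.
Qed.

Lemma eval_transfer z s d (u w : R) :
  eval_act z (transfer s d) (u, w) = (u + s * w, w - d * z * (u + s * w)).
Proof. by rewrite /eval_act !mxE /= !hornerE; congr (_, _); ring. Qed.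

Variables pos vel : nat -> R * R.
Hypothesis traj : magic_trajectory a b pos vel.

Let t k := step_time a b (pos k) (vel k).
Let c k := kick a b (pos k) (vel k).
Let T := transfer_prod t c.

Lemma traj_on_ellipse k : on_ellipse a b (pos k).
Proof. by case: (traj k). Qed.

Lemma traj_norm k : (vel k).1 ^+ 2 + (vel k).2 ^+ 2 = 1.
Proof. by case: (traj k). Qed.

Lemma traj_step k : [/\ lax_kappa a b (pos k) (vel k) < 0,
  pos k.+1 = step_pos a b (pos k) (vel k) &
  vel k.+1 = step_vel a b (pos k) (vel k)].
Proof. by case: (traj k) => E nv /(magic_stepE a0 b0 _ _ E nv). Qed.

Lemma traj_kappa k :
  lax_kappa a b (pos k) (vel k) = lax_kappa a b (pos 0%N) (vel 0%N).
Proof.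
elim: k => // k <-; have [_ -> ->] := traj_step k.
by apply: lax_kappa_step => //; [apply: traj_on_ellipse | apply: traj_norm].
Qed.

Lemma lax_at_step k : lax_at (pos k.+1) (vel k.+1) * transfer (t k) (c k) =
  transfer (t k) (c k) * lax_at (pos k) (vel k).
Proof.
have E := traj_on_ellipse k; have nv := traj_norm k.
have [_ -> ->] := traj_step k.
rewrite /lax_at lax_kappa_step //; apply: lax_transfer.
- exact: lax_eta_step.
- exact: lax_delta_step.
- exact: lax_mu_step.
- exact: step_timeE.
- exact: kick_etaE.
Qed.

Lemma lax_at_prod k :
  lax_at (pos k) (vel k) * T k = T k * lax_at (pos 0%N) (vel 0%N).
Proof.
elim: k => [|k IHk]; first by rewrite mulr1 mul1r.
by rewrite /T /= mulrA lax_at_step -!mulrA IHk.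
Qed.

Lemma step_time_gt0 k : 0 < t k.
Proof.
have [k0 _ _] := traj_step k.
by rewrite divr_gt0 ?lax_mu_gt0 ?traj_norm // oppr_gt0 pmulr_rlt0.
Qed.

Lemma kick_gt0 k : 0 < c k.
Proof.
have [k0 _ _] := traj_step k; rewrite divr_gt0 // ?oppr_gt0 ?pmulr_rlt0 //.
apply: lax_eta_gt0 => //; apply: on_ellipse_hit => //;
  first exact: traj_on_ellipse.
exact: traj_norm.
Qed.

Lemma eval_prod_a k : eval_act a^-1 (T k) ((pos 0%N).1, (vel 0%N).1) =
  ((pos k).1, (vel k).1).
Proof.
elim: k => [|k IHk]; first by rewrite eval_act1.
rewrite /T /= eval_actM IHk eval_transfer.
have [_ -> ->] := traj_step k.
by rewrite step_velE //; [apply: traj_on_ellipse | apply: traj_norm].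
Qed.

Lemma eval_prod_b k : eval_act b^-1 (T k) ((pos 0%N).2, (vel 0%N).2) =
  ((-1) ^+ k * (pos k).2, (-1) ^+ k * (vel k).2).
Proof.
elim: k => [|k IHk]; first by rewrite eval_act1 !mul1r.
rewrite /T /= eval_actM IHk eval_transfer.
have [_ -> ->] := traj_step k.
rewrite step_velE //; [|exact: traj_on_ellipse|exact: traj_norm].
rewrite exprS step_posE /= -/(t k) -/(c k).
by congr (_, _); ring.
Qed.

End Trajectory.

Section PencilShape.
Variable F : realFieldType.

(** The relation between the top coefficients of [P] and [g] makes them cancel in [P - g f] and add
    up in [P + g f]. *)
Lemma pencil_shape (eta kappa delta mu : F) n (P g : {poly F}) :
    (forall i, (n.+2 < i)%N -> P`_i = 0) -> (forall i, (n < i)%N -> g`_i = 0) ->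
    P`_n.+2 = kappa * g`_n -> P`_n.+2 != 0 ->
  transfer_shape n.+2 (pencil eta kappa delta mu P g).
Proof.
move=> hP hg E P0; rewrite /transfer_shape !mxE /=; split.
- case=> [|[|i]] //; rewrite !ltnS leq_eqVlt => /orP[/eqP <-|ni] _.
    by rewrite coefB coefMquad (hg n.+1) // (hg n.+2) 1?ltnW // E; ring.
  rewrite coefB coefMquad hP // (hg i) // (hg i.+1) 1?ltnW //.
  by rewrite (hg i.+2) 1?ltnW 1?ltnW //; ring.
- case=> [|[|i]] //; rewrite !ltnS => ni;
  rewrite coefMquad (hg i.+1) // (hg i.+2) 1?ltnW //.
  by ring.
- case=> [|[|i]] //; rewrite !ltnS => ni; rewrite coefN coefMquad.
  by rewrite (hg i) // (hg i.+1) 1?ltnW // (hg i.+2) 1?ltnW 1?ltnW //; ring.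
- case=> [|[|i]] //; rewrite !ltnS => ni; rewrite coefD coefMquad hP //.
  by rewrite (hg i) // (hg i.+1) 1?ltnW // (hg i.+2) 1?ltnW 1?ltnW //; ring.
- rewrite coefD coefMquad (hg n.+1) // (hg n.+2) 1?ltnW // E.
  have -> : kappa * g`_n + (kappa * g`_n + - delta * 0 + 0 * 0) = 2 * (kappa *
    g`_n) by ring.
  by rewrite -E mulf_neq0 ?pnatr_eq0.
Qed.

(** Shape 0 leaves a constant lower triangular matrix, and the values at 0 make it an upper shear as
    well. *)
Lemma transfer_shape0_eq1 (B C : 'M[{poly F}]_2) :
    transfer_shape 0 B ->
    (exists s, forall u, eval_act 0 C u = (u.1 + s * u.2, u.2)) ->
    (exists s, forall u, eval_act 0 (B * C) u = (u.1 + s * u.2, u.2)) ->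
  B = 1.
Proof.
move=> [h00 h01 h10 h11 _] [s C0] [r BC0].
have constE (p : {poly F}) : (forall i, (0 < i)%N -> p`_i = 0) ->
  p = (p.[0])%:P.
  by move=> hp; apply/polyP => -[|i]; rewrite coefC horner_coef0 // hp.
have b01 : B 0 1 = 0 by apply/polyP => i; rewrite h01 // coef0.
have E u : eval_act 0 B (u.1 + s * u.2, u.2) = (u.1 + r * u.2, u.2).
  by rewrite -C0 -eval_actM BC0.
have := E (1, 0); have := E (0, 1); rewrite /eval_act b01 horner0 /=.
rewrite !(mul0r, mulr0, mulr1, addr0, add0r) => -[_ e1] [e2 e3].
move: e1; rewrite e3 mul0r add0r => e1.
rewrite (mx2E B) b01 (constE _ (fun i =>
  h00 i isT)) (constE _ h10) (constE _ h11).
rewrite e1 e2 e3 polyC0 polyC1.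
by apply/esym; rewrite [LHS]mx2E !mxE.
Qed.

End PencilShape.

(** * Periodicity of a trajectory and the Pell equation *)

Section Periodicity.
Variables (R : realType) (a b beta : R).
Hypotheses (a0 : 0 < a) (b0 : 0 < b) (beta0 : 0 < beta).
Variables pos vel : nat -> R * R.
Hypothesis traj : magic_trajectory a b pos vel.
Hypothesis caustic : caustic_param a b (pos 0%N) (vel 0%N) = beta.

Let t k := step_time a b (pos k) (vel k).
Let c k := kick a b (pos k) (vel k).
Let T := transfer_prod t c.
Let kappa := lax_kappa a b (pos 0%N) (vel 0%N).

Lemma kappa_lt0 : kappa < 0.
Proof. by case: (traj_step a0 b0 traj 0). Qed.

Lemma kappa_sqr : kappa ^+ 2 = a * b * beta.
Proof. by rewrite -caustic; apply: lax_kappa_sqr => //;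
  apply: (traj_on_ellipse traj). Qed.

Definition pencil_at0 := pencil (lax_eta a b (pos 0%N)) kappa
  (lax_delta (pos 0%N) (vel 0%N)) (lax_mu a b (vel 0%N)).

(** Since [kappa ^+ 2 = a * b * beta], the Pell unknown is [kappa *: g] and the quartic becomes
    monic. *)
Lemma det_pencil_at0 P g : \det (pencil_at0 P g) =
  P ^+ 2 - monic_quartic a^-1 b^-1 beta^-1 * (kappa *: g) ^+ 2.
Proof.
rewrite /pencil_at0 det_pencil (@lax_spectral _ a b a0 b0 _ _ beta) //.
- by rewrite -kappa_sqr polyC_exp -mul_polyC; ring.
- exact: (traj_on_ellipse traj).
- exact: (traj_norm traj).
- by rewrite gt_eqF.
Qed.

Lemma transfer_prod_unit k : T k \is a GRing.unit.
Proof.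
have -> : (T k \is a GRing.unit) = (T k \in unitmx) by [].
by rewrite unitmxE det_transfer_prod unitr1.
Qed.

(** Induction on [k]: the remaining factor [B] intertwines the Lax matrices at times [k] and 0, so
    [transfer_shape_peel] splits off the matrix of the next bounce. *)
Lemma transfer_prod_factor M n : transfer_shape n M -> \det M = 1 ->
    M * lax_at a b (pos 0%N) (vel 0%N) = lax_at a b (pos 0%N) (vel 0%N) * M ->
  forall k, (k <= n)%N -> exists2 B, M = B * T k & transfer_shape (n - k) B.
Proof.
move=> shM dM cM; elim=> [|k IHk] kn.
  by exists M; rewrite ?mulr1 ?subn0.
have [B EB shB] := IHk (ltnW kn).
have dB : \det B = 1.
  by move: dM; rewrite EB det_mulmx det_transfer_prod mulr1.
have cB : B * lax_at a b (pos k) (vel k) = lax_at a b (pos 0%N) (vel 0%N) * B.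
  apply: (mulIr (transfer_prod_unit k)).
  by rewrite -mulrA (lax_at_prod a0 b0 traj) mulrA -EB cM EB mulrA.
have nk : (n - k = (n - k.+1).+1)%N by clear -kn; lia.
rewrite nk in shB.
have E := traj_on_ellipse traj k; have nv := traj_norm traj k.
move: cB; rewrite /lax_at (traj_kappa a0 b0 traj k) => cB.
have [| | |B' EB' shB'] := transfer_shape_peel (t := t k) (c := c k)
  (eta' := lax_eta a b (step_pos a b (pos k) (vel k)))
  (ltr0_neq0 kappa_lt0) _ _ _ cB dB shB.
- by apply: lax_eta_step.
- by rewrite /kappa -(traj_kappa a0 b0 traj k); apply: step_timeE.
- by rewrite /kappa -(traj_kappa a0 b0 traj k); apply: kick_etaE.
by exists B' => //; rewrite EB EB' /T /= mulrA.
Qed.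

Lemma pell_periodic n P Q : (0 < n)%N -> pell_at n a^-1 b^-1 beta^-1 P Q ->
  n_periodic n pos vel.
Proof.
move=> n0 pell; have [sQ Q0 lead] := pell_at_lead n0 pell.
case: pell => sP pellP P0 Pa Pb.
have k0 : kappa != 0 by rewrite ltr0_neq0 ?kappa_lt0.
(* The Pell equation fixes [Q] up to sign; [e] is the sign for which the top terms cancel as
   [pencil_shape] requires. *)
have [e e2 eE] : exists2 e, e ^+ 2 = 1 & lead_coef P = e * lead_coef Q.
  move/eqP: lead; rewrite eqf_sqr => /orP[]/eqP->.
    by exists 1; rewrite ?expr1n ?mul1r.
  by exists (-1); rewrite ?sqrrN ?expr1n ?mulN1r.
have [m mE] : exists m, n = m.+2.
  have : (0 < size Q)%N by rewrite lt0n size_poly_eq0.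
  by rewrite -sQ; case: (size Q) => // m _; exists m.
have {}sQ : size Q = m.+1 by move: sQ; rewrite mE => -[].
pose g := (e / kappa) *: Q; pose M := pencil_at0 P g.
have gE : kappa *: g = e *: Q by rewrite scalerA mulrCA divff ?mulr1.
have detM : \det M = 1.
  by rewrite det_pencil_at0 gE exprZn e2 scale1r pellP.
have shM : transfer_shape n M.
  rewrite mE; apply: pencil_shape.
  - by move=> i mi; apply: nth_default; rewrite sP mE.
  - by move=> i mi; rewrite coefZ nth_default ?mulr0 // sQ.
  - rewrite -coefZ gE coefZ; move: eE.
    by rewrite /lead_coef sP sQ mE.
  - have : P != 0 by rewrite -size_poly_eq0 sP.
    by rewrite -lead_coef_eq0 /lead_coef sP mE.
have [B MB shB] := transfer_prod_factor shM detM (pencil_comm _ _ _ _ _ _)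
  (leqnn n).
have B1 : B = 1.
  rewrite subnn in shB; apply: transfer_shape0_eq1 shB (transfer_prod0 t c n) _.
  by rewrite -MB; apply: pencil0.
move: MB; rewrite B1 mul1r => MT.
(* Now the pencil is the transfer product. At [1/a] and [1/b] it acts on the initial coordinates as
   the scalar [P], while the product gives the coordinates at time [n], with sign [(-1)^n] at
   [1/b]. *)
have EA := traj_on_ellipse traj 0; have nv := traj_norm traj 0.
have := eval_prod_a a0 b0 traj n; have := eval_prod_b a0 b0 traj n.
rewrite -/t -/c -/T -MT !eval_pencil ?eval_lax_at_a ?eval_lax_at_b //.
rewrite Pa Pb !mul1r /= => -[e3 e4] [e5 e6].
have s0 : (-1) ^+ n != 0 :> R by rewrite signr_eq0.
by split; rewrite [LHS]surjective_pairing [RHS]surjective_pairing;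
  congr (_, _) => //; apply: (mulfI s0).
Qed.

(** The closed trajectory makes the transfer product commute with the Lax matrix; [mu != eta] is for
    [comm_pencil], and the two nonzero coordinates let [P] be read off at [1/a] and [1/b]. *)
Lemma periodic_pell n : (0 < n)%N ->
    lax_mu a b (vel 0%N) != lax_eta a b (pos 0%N) ->
    (vel 0%N).1 != 0 -> (pos 0%N).2 != 0 ->
  n_periodic n pos vel -> exists P Q, pell_at n a^-1 b^-1 beta^-1 P Q.
Proof.
move=> n0 mue v10 A20 [posn veln].
have EA := traj_on_ellipse traj 0; have nv := traj_norm traj 0.
have eta0 : lax_eta a b (pos 0%N) != 0 by rewrite gt_eqF // lax_eta_gt0.
have cT : T n * lax_at a b (pos 0%N) (vel 0%N) = lax_at a b (pos 0%N) (vel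
  0%N) * T n.
  by rewrite -(lax_at_prod a0 b0 traj) posn veln.
have [g Tg] := comm_pencil eta0 mue cT.
set P := _ *: _ in Tg; exists P, (kappa *: g).
have [h00 _ _ h11 hn] : transfer_shape n (T n).
  apply: transfer_prod_shape => k; rewrite gt_eqF //;
    first exact: step_time_gt0.
  exact: kick_gt0.
have evx := eval_prod_a a0 b0 traj n; have evy := eval_prod_b a0 b0 traj n.
move: evx evy; rewrite -/t -/c -/T {1 2}Tg posn veln.
rewrite !eval_pencil ?eval_lax_at_a ?eval_lax_at_b //= => -[_ Pa] [Pb _].
split.
(* The degree is exactly [n]: only the lower right entry contributes to that coefficient of the
   trace. *)
- apply/eqP; rewrite eqn_leq; apply/andP; split.
    apply/leq_sizeP => i ni; rewrite coefZ coefD h00 ?(ltnW ni) //;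
      last exact: leq_ltn_trans ni.
    by rewrite h11 // addr0 mulr0.
  rewrite ltnNge; apply/negP => /leq_sizeP/(_ n (leqnn n)) /eqP.
  by rewrite coefZ coefD h00 // add0r mulf_eq0 invr_eq0 pnatr_eq0 (negPf hn).
- by rewrite -det_pencil_at0 /pencil_at0 -Tg det_transfer_prod.
- have [s ev0] := transfer_prod0 t c n.
  have := ev0 (1, 0); have := ev0 (0, 1);
    rewrite -/T /eval_act /= => -[_ e1] [e2 e3].
  rewrite /P hornerZ hornerD; move: e1 e2 e3.
  rewrite !(mul0r, mulr0, mulr1, addr0, add0r) => e1 e2 _.
  by rewrite e1 e2 -[1 + 1]/(2%:R) mulVf ?pnatr_eq0.
- by apply: (mulIf v10); rewrite mul1r.
- by apply: (mulIf A20).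
Qed.

End Periodicity.

(** * Existence of a generic trajectory with a given caustic *)

Section Existence.
Variables (R : realType) (a b beta : R).
Hypotheses (b0 : 0 < b) (ab : b < a) (beta0 : 0 < beta) (betaa : beta < a).
Hypothesis (betab : b != beta).

Let a0 : 0 < a := lt_trans b0 ab.

Definition iter_step A v (k : nat) : (R * R) * (R * R) :=
  iter k (fun s => (step_pos a b s.1 s.2, step_vel a b s.1 s.2)) (A, v).

Lemma iter_step_trajectory A v :
    on_ellipse a b A -> v.1 ^+ 2 + v.2 ^+ 2 = 1 -> lax_kappa a b A v < 0 ->
  magic_trajectory a b (fun k => (iter_step A v k).1) (fun k =>
    (iter_step A v k).2).
Proof.
move=> EA nv k0.
have inv k : [/\ on_ellipse a b (iter_step A v k).1,
    (iter_step A v k).2.1 ^+ 2 + (iter_step A v k).2.2 ^+ 2 = 1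
  & lax_kappa a b (iter_step A v k).1 (iter_step A v k).2 < 0].
  elim: k => [//|k [E n h]]; rewrite /iter_step iterS -/(iter_step A v k) /=.
  by split; [apply: on_ellipse_step|apply: norm_step|rewrite lax_kappa_step].
move=> k; have [E n h] := inv k; split=> //.
exact/(magic_stepE a0 b0 _ _ E n).
Qed.

Lemma traj_has_caustic (pos vel : nat -> R * R) :
    magic_trajectory a b pos vel ->
      caustic_param a b (pos 0%N) (vel 0%N) = beta ->
  has_caustic a b beta pos vel.
Proof.
move=> traj E k; apply/(tangent_confocalE _ (negbT (gt_eqF betaa)) betab
  (traj_norm traj k)).
have ab0 : a * b != 0 by rewrite mulf_neq0 // gt_eqF.
apply: (mulfI ab0); rewrite -E -!lax_kappa_sqr //;
  try exact: traj_on_ellipse traj _.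
by rewrite (traj_kappa a0 b0 traj).
Qed.

(** At this end of the short axis [caustic_param] equals [a * v.2 ^+ 2], so [beta / a] is the
    required square; the minus sign points the velocity inwards. *)
Let A : R * R := (0, Num.sqrt b).
Let v : R * R := (Num.sqrt (1 - beta / a), - Num.sqrt (beta / a)).

Lemma exists_trajectory : exists pos vel : nat -> R * R,
  [/\ magic_trajectory a b pos vel, has_caustic a b beta pos vel,
      lax_mu a b (vel 0%N) != lax_eta a b (pos 0%N),
      (vel 0%N).1 != 0 & (pos 0%N).2 != 0].
Proof.
have an : a != 0 by rewrite gt_eqF.
have ba0 : 0 < beta / a by rewrite divr_gt0.
have ba1 : 0 < 1 - beta / a by rewrite subr_gt0 ltr_pdivrMr // mul1r.
have v1 : v.1 ^+ 2 = 1 - beta / a by rewrite sqr_sqrtr ?ltW.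
have v2 : v.2 ^+ 2 = beta / a by rewrite sqrrN sqr_sqrtr ?ltW.
have A2 : A.2 ^+ 2 = b by rewrite sqr_sqrtr ?ltW.
have EA : on_ellipse a b A.
  by rewrite /on_ellipse A2 expr0n mul0r add0r divff ?gt_eqF.
have nv : v.1 ^+ 2 + v.2 ^+ 2 = 1 by rewrite v1 v2 subrK.
have k0 : lax_kappa a b A v < 0.
  rewrite /lax_kappa /= mulr0 mul0r add0r mulrN oppr_lt0.
  by rewrite !mulr_gt0 ?sqrtr_gt0.
have cE : caustic_param a b A v = beta.
  rewrite /caustic_param mul0r sub0r sqrrN exprMn A2 /lax_mu v1 v2.
  by field.
have traj := iter_step_trajectory EA nv k0.
exists (fun k => (iter_step A v k).1), (fun k => (iter_step A v k).2);
  split=> //.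
- exact: traj_has_caustic traj cE.
- rewrite /= /lax_mu v1 v2 /lax_eta A2 expr0n subr0 addrK lt_eqF // -subr_gt0.
  have -> : a - (b * (1 - beta / a) + a * (beta / a)) = (a - b) * (1 - beta /
    a).
    by field.
  by rewrite mulr_gt0 // subr_gt0.
- by rewrite /= sqrtr_eq0 -ltNge.
- by rewrite /= sqrtr_eq0 -ltNge.
Qed.

End Existence.

(** * Degree bookkeeping and the two parities *)

Lemma has_degreeE (R : realType) (p : {poly R}) (d : int) :
  has_degree p d <-> (size p)%:Z = Num.max (d + 1) 0.
Proof.
rewrite /has_degree; have [d0|d0] := leP 0 d.
  by rewrite max_l // addr_ge0.
rewrite max_r; last by lia.
by split=> [->|[/eqP]]; rewrite ?size_poly0 // size_poly_eq0 => /eqP.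
Qed.

Theorem corollary3p8 (R : realType) (a b beta : R) (n : nat)
    (hb : 0 < b) (hab : b < a)
    (hbeta : (0 < beta < b) || (b < beta < a)) (hn : (0 < n)%N) :
  (forall pos vel : nat -> R * R,
      magic_trajectory a b pos vel -> has_caustic a b beta pos vel ->
      n_periodic n pos vel)
  <->
  (exists (d1 d2 : int) (p q : {poly R}),
      [/\ has_degree p d1, has_degree q d2,
          forall m : nat, n = (2 * m)%N ->
            [/\ d1 = m%:Z, d2 = m%:Z - 2 &
                p ^+ 2 - 'X * ('X - (a^-1)%:P) * ('X - (b^-1)%:P)
                         * ('X - (beta^-1)%:P) * q ^+ 2 = 1]
        & forall m : nat, n = (2 * m + 1)%N ->
            [/\ d1 = m%:Z, d2 = m%:Z - 1 &
                ('X - (b^-1)%:P) * p ^+ 2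
                - 'X * ('X - (a^-1)%:P) * ('X - (beta^-1)%:P) * q ^+ 2
                = -1]]).
Proof.
have a0 : 0 < a := lt_trans hb hab.
have [beta0 betaa betab] : [/\ 0 < beta, beta < a & b != beta].
  case/orP: hbeta => /andP[h1 h2]; split=> //.
  - exact: lt_trans hab.
  - by rewrite gt_eqF.
  - exact: lt_trans h1.
  - by rewrite lt_eqF.
(* The Pell condition involves only [a], [b], [beta] and [n]: one generic trajectory yields it, and
   it makes every trajectory with this caustic periodic. *)
have -> : (forall pos vel : nat -> R * R,
    magic_trajectory a b pos vel -> has_caustic a b beta pos vel ->
    n_periodic n pos vel) <-> exists P Q, pell_at n a^-1 b^-1 beta^-1 P Q.
  split=> [per|[P [Q pell]] pos vel traj caus].
    have [pos [vel [traj caus mue v10 A20]]] :=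
      exists_trajectory hb hab beta0 betaa betab.
    apply: (periodic_pell a0 hb beta0 traj _ hn mue v10 A20 (per _ _ traj
      caus)).
    exact: (tangent_confocalE _ (negbT (gt_eqF betaa)) betab
      (traj_norm traj 0)).1 (caus 0%N).
  apply: (pell_periodic a0 hb beta0 traj _ hn pell).
  exact: (tangent_confocalE _ (negbT (gt_eqF betaa)) betab
      (traj_norm traj 0)).1 (caus 0%N).
have z10 : a^-1 != 0 by rewrite invr_eq0 gt_eqF.
have z20 : 0 < b^-1 by rewrite invr_gt0.
have z12 : a^-1 != b^-1 by rewrite (inj_eq invr_inj) gt_eqF.
have z23 : b^-1 != beta^-1 by rewrite (inj_eq invr_inj).
have [nodd|neven] := boolP (odd n); last first.
  have nE : n = (2 * n./2)%N by rewrite mul2n even_halfK.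
  move: (n./2) nE => m nE.
  rewrite (pell_even _ z10 _ z12 hn nE) ?gt_eqF //; split.
    move=> [p [q [sp sq q0 e]]]; exists m, (m%:Z - 2), p, q; split.
    - by apply/has_degreeE; rewrite sp; clear; lia.
    - by apply/has_degreeE; move: q0; rewrite -size_poly_eq0 -sq;
      move: (size q) => k; clear; lia.
    - by move=> m'; rewrite nE => E; have -> : m' = m by clear -E; lia.
    - by move=> m'; rewrite nE; clear; lia.
  move=> [d1 [d2 [p [q [dp dq /(_ m nE)[d1E d2E e] _]]]]].
  move: dp dq; rewrite d1E d2E => /has_degreeE sp /has_degreeE sq.
  have {}sp : size p = m.+1 by clear -sp; lia.
  (* Excludes the zero polynomial of negative degree, possible only for [m = 1]: then [p ^+ 2 = 1]
     although [p] has degree [m > 0]. *)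
  have q0 : q != 0.
    apply/eqP => q0; move: e; rewrite q0 expr0n mulr0 subr0.
    have p0 : p != 0 by rewrite -size_poly_eq0 sp.
    move=> /(congr1 (size : {poly R} -> nat));
      rewrite size_sqr // sp size_poly1.
    by move: hn; rewrite nE /=; clear; lia.
  exists p, q; split=> //; move: q0 sq; rewrite -size_poly_eq0;
    move: (size q) => k; clear; lia.
have nE : n = (2 * n./2 + 1)%N.
  by rewrite mul2n addn1 odd_halfK // prednK.
move: (n./2) nE => m nE.
rewrite (pell_odd z10 z20 z12 z23 nE); split.
  move=> [p [q [sp sq q0 e]]]; exists m, (m%:Z - 1), p, q; split.
  - by apply/has_degreeE; rewrite sp; clear; lia.
  - by apply/has_degreeE; move: q0; rewrite -size_poly_eq0 -sq;
    move: (size q) => k; clear; lia.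
  - by move=> m'; rewrite nE; clear; lia.
  - by move=> m'; rewrite nE => E; have -> : m' = m by clear -E; lia.
move=> [d1 [d2 [p [q [dp dq _ /(_ m nE)[d1E d2E e]]]]]].
move: dp dq; rewrite d1E d2E => /has_degreeE sp /has_degreeE sq.
have {}sp : size p = m.+1 by clear -sp; lia.
have p0 : p != 0 by rewrite -size_poly_eq0 sp.
(* If [q] were zero, as for [m = 0], a nonzero multiple of ['X - (b^-1)%:P] would be constant. *)
have q0 : q != 0.
  apply/eqP => q0; move: e; rewrite q0 expr0n mulr0 subr0 mulrC.
  move=> /(congr1 (size : {poly R} -> nat)).
  by rewrite size_mul_XsubC ?expf_neq0 // size_sqr // size_polyN size_poly1.
exists p, q; split=> //; move: q0 sq; rewrite -size_poly_eq0;
  move: (size q) => k; clear; lia.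
Qed.
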